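(* Let $n\geq 4$ and let $B\subset\mathbb{R}^{n+1}$ be a symmetric convex body such that all its hyperplane sections $\Gamma\cap B$ ($\Gamma$ a linear hyperplane of $\mathbb{R}^{n+1}$) are affine symmetric bodies of revolution which are all linearly equivalent to each other. Then $B$ is an ellipsoid.
   Context: A symmetric convex body is a compact convex subset of a finite-dimensional real vector space with nonempty interior, invariant under $x\mapsto -x$. A hyperplane is a codimension-one linear subspace; a hyperplane section of a set is its intersection with a hyperplane. Two sets are linearly equivalent if a linear isomorphism between their ambient spaces maps one onto the other. A symmetric convex body $K\subset\mathbb{R}^m$ is a symmetric body of revolution if it admits an axis of revolution: a 1-dimensional linear subspace $L$ such that every section of $K$ by an affine hyperplane $A$ orthogonal to $L$ is a closed Euclidean $(m-1)$-ball in $A$ centered at $A\cap L$ (possibly empty or a point); $L^\perp$ is then the associated hyperplane of revolution. An affine symmetric body of revolution is a convex body linearly equivalent to a symmetric body of revolution; images of an axis and its associated hyperplane of revolution under such an equivalence are called an axis of revolution and associated hyperplane of revolution of it. An ellipsoid is a set affinely equivalent to a closed Euclidean unit ball. *)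

(* Defs.v *)
From Stdlib Require Import Reals Lra Lia.
Open Scope R_scope.

(* Points of R^m are represented as functions nat -> R whose coordinates
   with index >= m vanish. *)
Definition vec := nat -> R.

Definition inR (m : nat) (x : vec) : Prop := forall i, (m <= i)%nat -> x i = 0.

Definition vzero : vec := fun _ => 0.
Definition vadd (x y : vec) : vec := fun i => x i + y i.
Definition vsub (x y : vec) : vec := fun i => x i - y i.
Definition vscale (r : R) (x : vec) : vec := fun i => r * x i.
Definition vopp (x : vec) : vec := fun i => - x i.

Fixpoint sumR (m : nat) (f : nat -> R) : R :=
  match m with O => 0 | S k => sumR k f + f k end.

Definition dot (m : nat) (x y : vec) : R := sumR m (fun i => x i * y i).
Definition norm2 (m : nat) (x : vec) : R := dot m x x.

Definition convex_set (K : vec -> Prop) : Prop :=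
  forall x y t, K x -> K y -> 0 <= t <= 1 ->
    K (vadd (vscale t x) (vscale (1 - t) y)).

Definition bounded_set (m : nat) (K : vec -> Prop) : Prop :=
  exists M, forall x, K x -> norm2 m x <= M.

Definition closed_set (K : vec -> Prop) : Prop :=
  forall (s : nat -> vec) (x : vec),
    (forall k, K (s k)) -> (forall i, Un_cv (fun k => s k i) (x i)) -> K x.

Definition nonempty_interior (m : nat) (K : vec -> Prop) : Prop :=
  exists x r, 0 < r /\ forall y, inR m y -> norm2 m (vsub y x) < r * r -> K y.

Definition symmetric_set (K : vec -> Prop) : Prop :=
  forall x, K x -> K (vopp x).

Definition sym_convex_body (m : nat) (K : vec -> Prop) : Prop :=
  (forall x, K x -> inR m x) /\ convex_set K /\ bounded_set m K /\
  closed_set K /\ nonempty_interior m K /\ symmetric_set K.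

(* Axis L = span(u), u a unit vector; every affine hyperplane {x | <x,u> = t}
   orthogonal to L meets K in a closed Euclidean ball centred at t u
   (possibly empty or a point). *)
Definition is_axis_of_revolution (m : nat) (K : vec -> Prop) (u : vec) : Prop :=
  inR m u /\ norm2 m u = 1 /\
  forall t : R,
    (forall x, inR m x -> dot m x u = t -> ~ K x) \/
    (exists r, 0 <= r /\
       forall x, inR m x -> dot m x u = t ->
         (K x <-> norm2 m (vsub x (vscale t u)) <= r * r)).

Definition sym_body_of_revolution (m : nat) (K : vec -> Prop) : Prop :=
  sym_convex_body m K /\ exists u, is_axis_of_revolution m K u.

(* V, W : linear subspaces (as predicates on vec); f is a linear bijection V -> W *)
Definition lin_iso (V W : vec -> Prop) (f : vec -> vec) : Prop :=
  (forall x, V x -> W (f x)) /\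
  (forall x y, V x -> V y -> f (vadd x y) = vadd (f x) (f y)) /\
  (forall r x, V x -> f (vscale r x) = vscale r (f x)) /\
  (forall x y, V x -> V y -> f x = f y -> x = y) /\
  (forall y, W y -> exists x, V x /\ f x = y).

Definition lin_equiv (V : vec -> Prop) (S : vec -> Prop)
                     (W : vec -> Prop) (S' : vec -> Prop) : Prop :=
  exists f, lin_iso V W f /\ forall y, S' y <-> exists x, S x /\ f x = y.

Definition affine_sym_body_of_revolution (n : nat) (Gamma S : vec -> Prop) : Prop :=
  exists K, sym_body_of_revolution n K /\ lin_equiv (inR n) K Gamma S.

Definition nonzero_vec (m : nat) (a : vec) : Prop :=
  inR m a /\ exists i, (i < m)%nat /\ a i <> 0.

Definition hyperplane (m : nat) (a : vec) : vec -> Prop :=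
  fun x => inR m x /\ dot m x a = 0.

Definition section (Gamma B : vec -> Prop) : vec -> Prop :=
  fun x => Gamma x /\ B x.

Definition unit_ball (m : nat) : vec -> Prop :=
  fun x => inR m x /\ norm2 m x <= 1.

Definition ellipsoid (m : nat) (E : vec -> Prop) : Prop :=
  exists (f : vec -> vec) (c : vec),
    lin_iso (inR m) (inR m) f /\ inR m c /\
    forall y, E y <-> exists x, unit_ball m x /\ vadd (f x) c = y.

(* Main.v *)
Require Import Defs.
From Stdlib Require Import Reals Lra Lia List Classical ClassicalEpsilon FunctionalExtensionality.
Open Scope R_scope.

(** Let [N] be the gauge of [B]. On a hyperplane [a^⊥], [N x] is a function of [P x A] and
    [P x x], where [P] is a positive definite form and [A] spans the axis; the equator is
    [P x A = 0]. Two revolution structures with different equators on a 3-dimensional space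
    force [N^2] to be quadratic: alternately rotating a vector about both axes moves it to the
    common equator along a quadric. Hence, if the parallelogram law fails for the pair [x, y],
    the equators of all hyperplanes through [x, y] agree on intersections, so they are cut out
    by a single linear form, given by a vector called the pole of [x, y]. Two failing pairs
    that span at most 3 dimensions have proportional poles, as [n + 1 >= 5]; any two failing
    pairs lie in a common hyperplane and are chained there through planes containing its
    axis, so there is only one pole. If no section were an ellipsoid, the hyperplane orthogonal
    to the pole would contain a failing pair, on which the pole would have to vanish; but a pole
    never vanishes on its own pair. So one section is an ellipsoid, hence all are, and the
    resulting quadratic forms glue to one on the whole space. *)

(** * A norm on R^3 with two axes of revolution *)

Lemma multiples_bounded_nonpos (v M : R) : (forall k, INR k * v <= M) -> v <= 0.
Proof.
  intros H. destruct (Rle_dec v 0) as [|Hv]; auto.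
  destruct (INR_unbounded (M / v)) as [k Hk].
  specialize (H k). apply Rnot_le_lt in Hv.
  apply (Rmult_gt_compat_r v) in Hk; auto.
  unfold Rdiv in Hk. rewrite Rmult_assoc, Rinv_l in Hk; lra.
Qed.

Lemma multiples_bounded_zero (v M : R) : (forall k, Rabs (INR k * v) <= M) -> v = 0.
Proof.
  intros H. apply Rle_antisym.
  - apply (multiples_bounded_nonpos v M). intros k.
    eapply Rle_trans; [apply Rle_abs | apply H].
  - assert (- v <= 0); [|lra].
    apply (multiples_bounded_nonpos _ M). intros k.
    eapply Rle_trans; [apply Rle_abs|].
    replace (INR k * - v) with (- (INR k * v)) by ring. rewrite Rabs_Ropp. apply H.
Qed.

Lemma sqr_bound (r c : R) : 0 <= c -> Rabs r <= c -> r ^ 2 <= c ^ 2.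
Proof. intros Hc H. apply pow_maj_Rabs; auto. Qed.

Ltac nonneg :=
  repeat first [ lra | apply Rplus_le_le_0_compat | apply pow2_ge_0 | apply Rmult_le_pos
    | apply Rabs_pos | apply sqrt_pos ].

(** Coordinates refer to a basis whose first vector spans the common line of the equators [z = 0]
    and [y = 0]. By [s1], at fixed [z] the norm is constant on circles of the [(x, y)]-plane about
    [(- p z, - q z)]; [s2] is the analogue at fixed [y]. The bounds [bdx] and [bdy] serve to exclude
    unbounded orbits. *)
Section TwoAxes.
Context (n : R -> R -> R -> R) (p q p' q' C : R)
  (hom : forall c x y z, n (c * x) (c * y) (c * z) = Rabs c * n x y z)
  (tri : forall x y z x' y' z', n (x + x') (y + y') (z + z') <= n x y z + n x' y' z')
  (bdx : forall x y z, Rabs x <= C * n x y z)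
  (bdy : forall x y z, Rabs y <= C * n x y z)
  (s1 : forall x y z x' y',
    (x + p * z) ^ 2 + (y + q * z) ^ 2 = (x' + p * z) ^ 2 + (y' + q * z) ^ 2 ->
    n x y z = n x' y' z)
  (s2 : forall x y z x' z',
    (x + p' * y) ^ 2 + (z + q' * y) ^ 2 = (x' + p' * y) ^ 2 + (z' + q' * y) ^ 2 ->
    n x y z = n x' y z').

(** The reflections [x -> - x - 2 p z] and [x -> - x - 2 p' y] are cases of [s1] and [s2]; their
    composite is a translation in [x], which can be iterated. *)
Lemma shear_x x y z k : n x y z = n (x + INR k * (2 * (p * z - p' * y))) y z.
Proof.
  induction k as [|k IH].
  - simpl. f_equal; ring.
  - rewrite IH. set (w := x + _).
    rewrite (s1 w y z (- w - 2 * p * z) y) by ring.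
    apply s2. unfold w. rewrite S_INR. ring.
Qed.

(** The translates of [(0, 0, 1)] all lie on one level of [n], so [bdx] forces the step [2 p] to
    vanish. *)
Lemma p_zero : p = 0.
Proof.
  assert (2 * p = 0); [|lra].
  apply (multiples_bounded_zero _ (C * n 0 0 1)). intros k.
  rewrite (shear_x 0 0 1 k).
  eapply Rle_trans; [|apply bdx]. right. f_equal. ring.
Qed.

Lemma p'_zero : p' = 0.
Proof.
  assert (-2 * p' = 0); [|lra].
  apply (multiples_bounded_zero _ (C * n 0 1 0)). intros k.
  rewrite (shear_x 0 1 0 k).
  eapply Rle_trans; [|apply bdx]. right. f_equal. ring.
Qed.

(** The reflections [y -> - y - 2 q z] and [z -> - z - 2 q' y] compose to a linear map of the
    [(y, z)]-plane of determinant 1 and trace [4 q q' - 2]. For [q q' = 1] it is unipotent and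
    preserves [y + q z]; its orbits grow linearly, against [bdy]. *)
Lemma shear_yz y z k : q * q' = 1 ->
  n 0 y z = n 0 (y - INR k * (2 * (y + q * z))) (z + INR k * (2 * q' * (y + q * z))).
Proof.
  intros Hk. induction k as [|k IH].
  - simpl. f_equal; ring.
  - rewrite IH. set (y1 := y - _). set (z1 := z + _).
    pose proof p_zero as Hp. pose proof p'_zero as Hp'.
    rewrite (s1 0 y1 z1 0 (- y1 - 2 * q * z1)) by (rewrite Hp; ring).
    rewrite (s2 0 (- y1 - 2 * q * z1) z1 0 (- z1 - 2 * q' * (- y1 - 2 * q * z1)))
      by (rewrite Hp'; ring).
    assert (E : q * z1 + y1 = y + q * z)
      by (unfold y1, z1; replace (q * (z + INR k * (2 * q' * (y + q * z))))
          with (q * z + INR k * (2 * (q * q') * (y + q * z))) by ring; rewrite Hk; ring).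
    f_equal.
    + replace (- y1 - 2 * q * z1) with (y1 - 2 * (q * z1 + y1)) by ring.
      rewrite E, S_INR. unfold y1. ring.
    + replace (- z1 - 2 * q' * (- y1 - 2 * q * z1))
        with (- z1 + 2 * q' * (q * z1 + y1) + 2 * (q * q') * z1) by ring.
      rewrite E, Hk, S_INR. unfold z1. ring.
Qed.

Lemma kappa_neq1 : q * q' <> 1.
Proof.
  intros Hk. assert (2 = 0); [|lra].
  apply (multiples_bounded_zero _ (C * n 0 1 0 + 1)). intros k.
  rewrite (shear_yz 1 0 k Hk).
  set (z1 := 0 + _). set (y1 := 1 - _).
  assert (H := bdy 0 y1 z1).
  replace (INR k * 2) with (1 - y1) by (unfold y1; ring).
  eapply Rle_trans; [apply Rabs_triang|]. rewrite Rabs_R1, Rabs_Ropp. lra.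
Qed.

Let k := q * q'.
Let w := (1 - k) ^ 2 * (1 + q ^ 2).

(** The vectors [(r, - q t, t)] form the plane of the common equator line and the first axis. At
    fixed [y = - q t], a rotation about the second axis moves [z] to [k t], where [z + q' y = 0]; at
    fixed [z = k t], a rotation about the first axis returns to the plane. In total [r ^ 2] gains
    [w t ^ 2]. *)
Lemma two_rotations r t r' : r' ^ 2 = r ^ 2 + w * t ^ 2 ->
  n r (- q * t) t = n r' (- q * (k * t)) (k * t).
Proof.
  intros H.
  pose proof p_zero as Hp. pose proof p'_zero as Hp'.
  set (r1 := sqrt (r ^ 2 + (1 - k) ^ 2 * t ^ 2)).
  assert (Hr1 : r1 ^ 2 = r ^ 2 + (1 - k) ^ 2 * t ^ 2).
  { unfold r1. rewrite pow2_sqrt; auto. nonneg. }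
  transitivity (n r1 (- q * t) (k * t)).
  - apply s2. rewrite Hp'. replace (r1 + 0 * (- q * t)) with r1 by ring. rewrite Hr1.
    unfold k. ring.
  - apply s1. rewrite Hp. replace (r1 + 0 * (k * t)) with r1 by ring.
    replace (r' + 0 * (k * t)) with r' by ring. rewrite H, Hr1. unfold w, k. ring.
Qed.

Lemma w_pos : 0 < w.
Proof.
  unfold w. assert (1 - k <> 0) by (pose proof kappa_neq1; unfold k; lra).
  apply Rmult_lt_0_compat; [|nra]. rewrite <- Rsqr_pow2. apply Rsqr_pos_lt; auto.
Qed.

(** If [|k| >= 1], then [|t|] never shrinks along the double rotations started at [(0, - q, 1)], so
    each of them adds at least [w > 0] to [r ^ 2], against [bdx]. *)
Lemma kappa_small : Rabs k < 1.
Proof.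
  destruct (Rlt_dec (Rabs k) 1) as [|Hk]; auto. exfalso. apply Rnot_lt_le in Hk.
  pose proof w_pos as Hw.
  assert (H : forall j, exists r t, 1 <= t ^ 2 /\ INR j * w <= r ^ 2 /\
      n 0 (- q * 1) 1 = n r (- q * t) t).
  { induction j as [|j [r [t [Ht [Hr E]]]]].
    - exists 0, 1. simpl. repeat split; lra.
    - assert (0 <= r ^ 2) by nonneg. assert (0 <= w * t ^ 2) by nonneg.
      exists (sqrt (r ^ 2 + w * t ^ 2)), (k * t). rewrite pow2_sqrt by lra.
      repeat split.
      + assert (1 <= k ^ 2).
        { rewrite <- (pow1 2). rewrite <- (pow2_abs k). apply pow_incr; lra. }
        nra.
      + rewrite S_INR. nra.
      + rewrite E. apply two_rotations. rewrite pow2_sqrt; lra. }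
  assert (w <= 0); [|lra].
  apply (multiples_bounded_nonpos _ ((C * n 0 (- q * 1) 1) ^ 2)). intros j.
  destruct (H j) as [r [t [_ [Hr ->]]]].
  eapply Rle_trans; [apply Hr|]. assert (B := bdx r (- q * t) t).
  apply sqr_bound; auto. eapply Rle_trans; [apply Rabs_pos|apply B].
Qed.

Lemma n_scale_x r : n r 0 0 = Rabs r * n 1 0 0.
Proof. rewrite <- hom. f_equal; ring. Qed.

(* Chosen so that [two_rotations] preserves [r ^ 2 + mu * t ^ 2]. *)
Let mu := w / (1 - k ^ 2).

(** Repeated double rotations replace [t] by [k ^ j t], which tends to 0, and preserve
    [r ^ 2 + mu t ^ 2]. The vector is driven to the common equator line, and the triangle inequality
    bounds the remaining discrepancy by [|k| ^ j D]. *)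
Lemma axis_plane_quadratic r t : n r (- q * t) t = sqrt (r ^ 2 + mu * t ^ 2) * n 1 0 0.
Proof.
  pose proof kappa_small as Hk. pose proof w_pos as Hw.
  assert (Hk2 : 0 < 1 - k ^ 2).
  { assert (k ^ 2 < 1); [|lra]. rewrite <- pow2_abs. pose proof (Rabs_pos k). nra. }
  assert (Hmu : 0 < mu) by (apply Rdiv_lt_0_compat; lra).
  assert (Emu : w = mu * (1 - k ^ 2)) by (unfold mu; field; lra).
  assert (H : forall j, exists s, 0 <= s /\ s ^ 2 + mu * (k ^ j * t) ^ 2 = r ^ 2 + mu * t ^ 2
     /\ n r (- q * t) t = n s (- q * (k ^ j * t)) (k ^ j * t)).
  { induction j as [|j [s [Hs [Es E]]]].
    - exists (Rabs r). repeat split; [apply Rabs_pos| |].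
      + rewrite pow2_abs. simpl. ring.
      + pose proof p_zero as Hp.
        replace (k ^ 0 * t) with t by (simpl; ring).
        apply s1. rewrite Hp, !Rmult_0_l, !Rplus_0_r, pow2_abs. ring.
    - assert (0 <= s ^ 2) by nonneg. assert (0 <= w * (k ^ j * t) ^ 2) by nonneg.
      exists (sqrt (s ^ 2 + w * (k ^ j * t) ^ 2)). rewrite pow2_sqrt by lra.
      repeat split; [apply sqrt_pos| |].
      + rewrite <- Es, Emu. simpl. ring.
      + rewrite E. replace (k ^ S j * t) with (k * (k ^ j * t)) by (simpl; ring).
        apply two_rotations. rewrite pow2_sqrt; lra. }
  set (S := r ^ 2 + mu * t ^ 2) in *.
  (* [D] collects two errors at [v = k ^ j t]: dropping the axis component costs [|v| n 0 (- q) 1],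
     and replacing [s] by [sqrt S] costs at most [sqrt mu |v| n 1 0 0]. *)
  set (D := Rabs t * (n 0 (- q) 1 + sqrt mu * n 1 0 0)).
  assert (n100 : 0 <= n 1 0 0).
  { pose proof (tri 1 0 0 (-1) 0 0) as T.
    replace (n (-1) 0 0) with (n 1 0 0) in T.
    2: { rewrite (n_scale_x (-1)), Rabs_left by lra. ring. }
    replace (n (1 + -1) (0 + 0) (0 + 0)) with 0 in T; [lra|].
    replace (1 + -1) with 0 by ring. replace (0 + 0) with 0 by ring.
    rewrite (n_scale_x 0), Rabs_R0. ring. }
  assert (Hb : forall j, Rabs (n r (- q * t) t - sqrt S * n 1 0 0) <= Rabs k ^ j * D).
  { intros j. destruct (H j) as [s [Hs [Es ->]]]. set (v := k ^ j * t) in *.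
    assert (Hv : Rabs v = Rabs k ^ j * Rabs t) by (unfold v; rewrite Rabs_mult, RPow_abs; auto).
    assert (HA : n 0 (- q * v) v = Rabs v * n 0 (- q) 1).
    { rewrite <- hom. f_equal; ring. }
    assert (HA' : n 0 (- q * - v) (- v) = Rabs v * n 0 (- q) 1).
    { rewrite <- (Rabs_Ropp v), <- hom. f_equal; ring. }
    assert (U : n s (- q * v) v <= s * n 1 0 0 + Rabs v * n 0 (- q) 1).
    { rewrite <- HA. rewrite <- (Rabs_right s) at 2 by lra. rewrite <- n_scale_x.
      eapply Rle_trans; [|apply tri]. right; f_equal; ring. }
    assert (L : s * n 1 0 0 <= n s (- q * v) v + Rabs v * n 0 (- q) 1).
    { rewrite <- HA'. rewrite <- (Rabs_right s) at 1 by lra. rewrite <- n_scale_x.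
      eapply Rle_trans; [|apply tri]. right; f_equal; ring. }
    assert (Q1 : s <= sqrt S).
    { rewrite <- (sqrt_pow2 s) by lra. apply sqrt_le_1_alt. rewrite <- Es. nra. }
    assert (Q2 : sqrt S <= s + sqrt mu * Rabs v).
    { pose proof (sqrt_pos mu). pose proof (Rabs_pos v).
      rewrite <- (sqrt_pow2 (s + sqrt mu * Rabs v)) by nra.
      apply sqrt_le_1_alt. rewrite <- Es.
      replace (mu * v ^ 2) with ((sqrt mu) ^ 2 * (Rabs v) ^ 2)
        by (rewrite pow2_sqrt, pow2_abs by lra; ring).
      assert (0 <= sqrt mu * Rabs v) by nra. nra. }
    unfold D. apply Rabs_le.
    replace (Rabs k ^ j * (Rabs t * (n 0 (- q) 1 + sqrt mu * n 1 0 0)))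
      with (Rabs v * n 0 (-q) 1 + sqrt mu * Rabs v * n 1 0 0) by (rewrite Hv; ring).
    assert (s * n 1 0 0 <= sqrt S * n 1 0 0) by nra.
    assert (sqrt S * n 1 0 0 <= (s + sqrt mu * Rabs v) * n 1 0 0) by nra.
    assert (0 <= sqrt mu * Rabs v * n 1 0 0).
    { pose proof (sqrt_pos mu). pose proof (Rabs_pos v).
      assert (0 <= sqrt mu * Rabs v) by nra. nra. }
    lra. }
  apply Rminus_diag_uniq.
  set (X := n r (- q * t) t - sqrt S * n 1 0 0) in *.
  destruct (Req_dec X 0) as [|HX]; auto. exfalso.
  apply Rabs_pos_lt in HX.
  assert (HD : 0 < D).
  { specialize (Hb 0%nat). simpl in Hb. lra. }
  destruct (pow_lt_1_zero k Hk (Rabs X / D)) as [j0 Hj].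
  { apply Rdiv_lt_0_compat; auto. }
  specialize (Hj j0 (le_n _)). specialize (Hb j0).
  rewrite <- RPow_abs in Hj.
  apply (Rmult_lt_compat_r D) in Hj; auto.
  unfold Rdiv in Hj. rewrite Rmult_assoc, Rinv_l in Hj; lra.
Qed.

(** A rotation about the first axis brings every vector into the plane [y = - q z], where the norm
    is already known. *)
Lemma two_axes_quadratic : exists c d, forall x y z,
  n x y z ^ 2 = c * ((x + p * z) ^ 2 + (y + q * z) ^ 2) + d * z ^ 2.
Proof.
  exists (n 1 0 0 ^ 2), (mu * n 1 0 0 ^ 2). intros x y z.
  set (g := (x + p * z) ^ 2 + (y + q * z) ^ 2).
  assert (Hg : 0 <= g) by (unfold g; nonneg).
  rewrite (s1 x y z (sqrt g) (- q * z)).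
  2: { rewrite p_zero at 2. rewrite Rmult_0_l, Rplus_0_r, pow2_sqrt by auto. unfold g. ring. }
  rewrite axis_plane_quadratic, Rpow_mult_distr, (pow2_sqrt g) by auto.
  rewrite (pow2_sqrt (g + _)); [ring|].
  assert (0 < 1 - k ^ 2).
  { pose proof kappa_small. assert (k ^ 2 < 1); [|lra]. rewrite <- pow2_abs. pose proof (Rabs_pos k). nra. }
  assert (0 < mu) by (apply Rdiv_lt_0_compat; [apply w_pos|lra]).
  nonneg.
Qed.
End TwoAxes.

(** * Linear algebra *)

Ltac vext := apply functional_extensionality; intro; unfold vadd, vsub, vscale, vopp, vzero.

Lemma sumR_ext m f g : (forall i, (i < m)%nat -> f i = g i) -> sumR m f = sumR m g.
Proof.
  induction m as [|m IH]; simpl; intros H; auto. rewrite IH, (H m); auto; lia.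
Qed.

Lemma sumR_add m f g : sumR m (fun i => f i + g i) = sumR m f + sumR m g.
Proof. induction m as [|m IH]; simpl; [|rewrite IH]; ring. Qed.

Lemma sumR_scale m c f : sumR m (fun i => c * f i) = c * sumR m f.
Proof. induction m as [|m IH]; simpl; [|rewrite IH]; ring. Qed.

Lemma sumR_zero m f : (forall i, (i < m)%nat -> f i = 0) -> sumR m f = 0.
Proof.
  intros H. rewrite (sumR_ext m f (fun i => 0 * f i)).
  - rewrite sumR_scale; ring.
  - intros i Hi. rewrite H; auto; ring.
Qed.

Lemma dot_sym m x y : dot m x y = dot m y x.
Proof. apply sumR_ext; intros; ring. Qed.

Lemma dot_add_l m x y z : dot m (vadd x y) z = dot m x z + dot m y z.
Proof. unfold dot. rewrite <- sumR_add. apply sumR_ext; intros; unfold vadd; ring. Qed.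

Lemma dot_scale_l m c x z : dot m (vscale c x) z = c * dot m x z.
Proof. unfold dot. rewrite <- sumR_scale. apply sumR_ext; intros; unfold vscale; ring. Qed.

Lemma vsub_eq x y : vsub x y = vadd x (vscale (-1) y).
Proof. vext; ring. Qed.

Lemma vscale_vscale c d x : vscale c (vscale d x) = vscale (c * d) x.
Proof. vext; ring. Qed.

Lemma vscale_1 x : vscale 1 x = x.
Proof. vext; ring. Qed.

Lemma inR_add m x y : inR m x -> inR m y -> inR m (vadd x y).
Proof. intros Hx Hy i Hi. unfold vadd. rewrite Hx, Hy; auto; ring. Qed.

Lemma inR_scale m c x : inR m x -> inR m (vscale c x).
Proof. intros Hx i Hi. unfold vscale. rewrite Hx; auto; ring. Qed.

Lemma norm2_ge0 m x : 0 <= norm2 m x.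
Proof.
  unfold norm2, dot. induction m as [|m IH]; simpl; [lra|]. nra.
Qed.

Lemma norm2_zero m x : inR m x -> norm2 m x = 0 -> x = vzero.
Proof.
  intros Hx H. apply functional_extensionality. intro i. unfold vzero.
  destruct (Compare_dec.le_lt_dec m i) as [Hi|Hi]; [auto|].
  clear Hx. unfold norm2 in H. induction m as [|m IH]; [lia|].
  unfold dot in *. simpl in H.
  pose proof (norm2_ge0 m x) as P. unfold norm2, dot in P.
  destruct (PeanoNat.Nat.eq_dec i m) as [->|Hne]; [nra|].
  apply IH; [nra|lia].
Qed.

Lemma nonzero_vec_norm2 m a : nonzero_vec m a <-> inR m a /\ 0 < norm2 m a.
Proof.
  split.
  - intros [Ha [i [Hi Hne]]]. split; auto.
    destruct (Rle_lt_or_eq_dec _ _ (norm2_ge0 m a)) as [|E]; auto.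
    symmetry in E. apply norm2_zero in E; auto. rewrite E in Hne. now elim Hne.
  - intros [Ha Hn]. split; auto. apply NNPP. intros H.
    unfold norm2, dot in Hn. rewrite sumR_zero in Hn; [lra|].
    intros i Hi. destruct (Req_dec (a i) 0) as [->|Hne]; [ring|].
    elim H. exists i; auto.
Qed.

Lemma nonzero_vec_neq m a : nonzero_vec m a <-> inR m a /\ a <> vzero.
Proof.
  rewrite nonzero_vec_norm2. split; intros [Ha H]; split; auto.
  - intros ->. unfold norm2, dot in H. rewrite sumR_zero in H; [lra|].
    intros; unfold vzero; ring.
  - destruct (Rle_lt_or_eq_dec _ _ (norm2_ge0 m a)) as [|E]; auto.
    elim H. apply (norm2_zero m); auto.
Qed.

Definition delta (k : nat) : vec := fun i => if PeanoNat.Nat.eq_dec i k then 1 else 0.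

Lemma delta_self k : delta k k = 1.
Proof. unfold delta. destruct PeanoNat.Nat.eq_dec; congruence. Qed.

Lemma delta_neq k i : i <> k -> delta k i = 0.
Proof. unfold delta. destruct PeanoNat.Nat.eq_dec; congruence. Qed.

Lemma inR_delta m k : (k < m)%nat -> inR m (delta k).
Proof. intros Hk i Hi. apply delta_neq. lia. Qed.

(** Induction by elimination: a vector [w] with nonzero last coordinate clears that coordinate in
    the others, and the last coordinate of the solution is then adjusted to make it orthogonal to
    [w]. Without such a [w], the last basis vector works. *)
Lemma exists_orthogonal m : forall l : list vec, (length l < m)%nat ->
  exists a, nonzero_vec m a /\ forall v, In v l -> dot m v a = 0.
Proof.
  induction m as [|m IH]; intros l Hl; [lia|].
  destruct (classic (exists w, In w l /\ w m <> 0)) as [[w [Hw Hwm]]|Hno].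
  - destruct (in_split w l Hw) as [l1 [l2 ->]].
    pose (red := fun v => vadd v (vscale (- (v m / w m)) w)).
    destruct (IH (map red (l1 ++ l2))) as [a [[Ha [i [Hi Hai]]] Horth]].
    { rewrite length_map. rewrite length_app in *. simpl in Hl. lia. }
    pose (s := - dot m w a / w m).
    exists (vadd a (vscale s (delta m))). split.
    + split.
      * intros j Hj. unfold vadd, vscale. rewrite Ha, delta_neq by lia. ring.
      * exists i. split; [lia|]. unfold vadd, vscale. rewrite delta_neq by lia. lra.
    + assert (E : forall v, dot (S m) v (vadd a (vscale s (delta m))) = dot m v a + s * v m).
      { intros v. unfold dot at 1. simpl. unfold vadd at 2, vscale at 2.
        rewrite delta_self, (Ha m) by lia. unfold dot.
        rewrite (sumR_ext m _ (fun i => v i * a i)); [ring|].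
        intros j Hj. unfold vadd, vscale. rewrite delta_neq by lia. ring. }
      assert (Ew : dot m w a + s * w m = 0) by (unfold s; field; auto).
      intros v Hv. rewrite E.
      assert (Hv' : v = w \/ In v (l1 ++ l2)).
      { rewrite in_app_iff in *. simpl in Hv. intuition. }
      destruct Hv' as [->|Hv']; auto.
      specialize (Horth (red v) (in_map red _ _ Hv')).
      unfold red in Horth. rewrite dot_add_l, dot_scale_l in Horth.
      replace (dot m v a) with (v m / w m * dot m w a) by lra.
      unfold s. field; auto.
  - exists (delta m). split.
    + split; [apply inR_delta; lia|]. exists m. split; [lia|]. rewrite delta_self; lra.
    + intros v Hv. unfold dot. apply sumR_zero. intros i Hi.
      destruct (PeanoNat.Nat.eq_dec i m) as [->|Hne].
      * destruct (Req_dec (v m) 0) as [->|H]; [ring|]. elim Hno; eauto.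
      * rewrite delta_neq by auto. ring.
Qed.

Lemma functional_is_dot m (L : vec -> R) :
  (forall x y, inR m x -> inR m y -> L (vadd x y) = L x + L y) ->
  (forall c x, inR m x -> L (vscale c x) = c * L x) ->
  exists p, inR m p /\ forall x, inR m x -> L x = dot m x p.
Proof.
  intros Hadd Hsc.
  assert (H0 : L vzero = 0).
  { replace vzero with (vscale 0 vzero) by (vext; ring). rewrite Hsc; [ring|].
    intros i Hi; auto. }
  exists (fun i => if Compare_dec.lt_dec i m then L (delta i) else 0). split.
  - intros i Hi. destruct Compare_dec.lt_dec; [lia|auto].
  - assert (H : forall k, (k <= m)%nat -> forall x, inR k x ->
       L x = sumR k (fun i => x i * L (delta i))).
    { induction k as [|k IH]; intros Hk x Hx.
      - simpl. replace x with vzero; auto. vext. symmetry. apply Hx. lia.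
      - simpl. pose (y := fun i => if PeanoNat.Nat.eq_dec i k then 0 else x i).
        assert (Hy : inR k y).
        { intros i Hi. unfold y. destruct PeanoNat.Nat.eq_dec; auto. apply Hx; lia. }
        assert (E : x = vadd y (vscale (x k) (delta k))).
        { vext. unfold y, delta. destruct PeanoNat.Nat.eq_dec; subst; ring. }
        rewrite E at 1. rewrite Hadd, Hsc.
        + f_equal. rewrite IH by (auto; lia). apply sumR_ext. intros i Hi.
          unfold y. destruct PeanoNat.Nat.eq_dec; [lia|auto].
        + apply inR_delta; lia.
        + intros i Hi. apply Hy; lia.
        + apply inR_scale, inR_delta; lia. }
    intros x Hx. rewrite (H m); auto. apply sumR_ext. intros i Hi.
    destruct Compare_dec.lt_dec; [auto|lia].
Qed.

(** * Norms of revolution on hyperplanes *)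

Lemma hyperplane_add m a x y : hyperplane m a x -> hyperplane m a y -> hyperplane m a (vadd x y).
Proof.
  intros [Hx Ex] [Hy Ey]. split; [apply inR_add; auto|]. rewrite dot_add_l, Ex, Ey; ring.
Qed.

Lemma hyperplane_scale m a c x : hyperplane m a x -> hyperplane m a (vscale c x).
Proof. intros [Hx Ex]. split; [apply inR_scale; auto|]. rewrite dot_scale_l, Ex; ring. Qed.

Lemma hyperplane_sub m a x y : hyperplane m a x -> hyperplane m a y -> hyperplane m a (vsub x y).
Proof. intros. rewrite vsub_eq. apply hyperplane_add; auto. apply hyperplane_scale; auto. Qed.

Ltac hyp := repeat first
  [ assumption | apply hyperplane_sub | apply hyperplane_add | apply hyperplane_scale ].

(** Symmetry is included. The laws hold on all of [vec], so rewriting raises no side conditions;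
    positivity is asked only on a hyperplane, in [revolution]. *)
Record bilinear (P : vec -> vec -> R) : Prop := {
  bil_add : forall x y z, P (vadd x y) z = P x z + P y z;
  bil_scale : forall c x z, P (vscale c x) z = c * P x z;
  bil_sym : forall x y, P x y = P y x }.

Lemma bil_add_r P : bilinear P -> forall x y z, P z (vadd x y) = P z x + P z y.
Proof. intros H x y z. rewrite (bil_sym P H), bil_add, (bil_sym P H x), (bil_sym P H y); auto. Qed.

Lemma bil_scale_r P : bilinear P -> forall c x z, P z (vscale c x) = c * P z x.
Proof. intros H c x z. rewrite (bil_sym P H), bil_scale, (bil_sym P H x); auto. Qed.

Ltac bil H := rewrite ?vsub_eq;
  repeat rewrite ?(bil_add _ H), ?(bil_add_r _ H), ?(bil_scale _ H), ?(bil_scale_r _ H).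

Lemma bilinear_combination P A c d : bilinear P ->
  bilinear (fun x y => c * P x y + d * (P x A * P y A)).
Proof.
  intros H. split; intros; bil H; [ring|ring|]. rewrite (bil_sym _ H x y). ring.
Qed.

(** [norm_bound] is a quantitative form of definiteness on [inR m]; on the rest of [vec], [N] is
    only a seminorm. *)
Record is_norm (m : nat) (N : vec -> R) : Prop := {
  norm_scale : forall c x, N (vscale c x) = Rabs c * N x;
  norm_add : forall x y, N (vadd x y) <= N x + N y;
  norm_bound : exists M, 0 <= M /\ forall x, inR m x -> norm2 m x <= M * N x ^ 2 }.

Definition parallelogram (N : vec -> R) (x y : vec) : Prop :=
  N (vadd x y) ^ 2 + N (vsub x y) ^ 2 = 2 * N x ^ 2 + 2 * N y ^ 2.

(** [P] is a Euclidean structure on [a^⊥] and [A] a unit axis vector. The values [P x A] and [P x x]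
    determine the orbit of [x] under the isometries of [P] fixing [A], so [rev_inv] is invariance
    under these. *)
Record revolution (m : nat) (N : vec -> R) (a : vec) (P : vec -> vec -> R) (A : vec) : Prop := {
  rev_bil : bilinear P;
  rev_pos : forall x, hyperplane m a x -> x <> vzero -> 0 < P x x;
  rev_axis : hyperplane m a A;
  rev_unit : P A A = 1;
  rev_inv : forall x y, hyperplane m a x -> hyperplane m a y ->
    P x A = P y A -> P x x = P y y -> N x = N y }.

Section Norm.
Context (m : nat) (N : vec -> R) (HN : is_norm m N).

Lemma norm_scale2 c x : N (vscale c x) ^ 2 = c ^ 2 * N x ^ 2.
Proof. rewrite (norm_scale _ _ HN), Rpow_mult_distr, pow2_abs. auto. Qed.

Lemma norm_zero : N vzero = 0.
Proof.
  replace vzero with (vscale 0 vzero) by (vext; ring).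
  rewrite (norm_scale _ _ HN), Rabs_R0; ring.
Qed.

Lemma norm_ge0 x : 0 <= N x.
Proof.
  pose proof (norm_add _ _ HN x (vscale (-1) x)) as H.
  rewrite (norm_scale _ _ HN), Rabs_left in H by lra.
  replace (vadd x (vscale (-1) x)) with vzero in H by (vext; ring).
  rewrite norm_zero in H. lra.
Qed.

Lemma norm_pos x : inR m x -> x <> vzero -> 0 < N x.
Proof.
  intros Hx Hne. destruct (norm_ge0 x) as [|E]; auto.
  elim Hne. apply (norm2_zero m); auto.
  destruct (norm_bound _ _ HN) as [M [HM Hb]]. specialize (Hb x Hx).
  rewrite <- E in Hb. pose proof (norm2_ge0 m x). simpl in Hb. lra.
Qed.

Lemma dot_bounded p : exists C, 0 <= C /\ forall x, inR m x -> Rabs (dot m x p) <= C * N x.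
Proof.
  destruct (norm_bound _ _ HN) as [M [HM Hb]].
  exists ((M + norm2 m p) / 2). pose proof (norm2_ge0 m p). split; [lra|].
  intros x Hx. destruct (classic (x = vzero)) as [->|Hne].
  { unfold dot. rewrite sumR_zero by (intros; unfold vzero; ring).
    rewrite norm_zero, Rabs_R0. lra. }
  pose proof (norm_pos x Hx Hne) as Hp.
  set (y := vscale (/ N x) x).
  assert (Hy : inR m y) by (apply inR_scale; auto).
  assert (Ny : norm2 m y <= M).
  { eapply Rle_trans; [apply Hb; auto|]. unfold y. rewrite norm_scale2.
    right. field. lra. }
  replace x with (vscale (N x) y) at 1 by (unfold y; vext; field; lra).
  rewrite dot_scale_l, Rabs_mult, (Rabs_right (N x)) by lra.
  (* With [c = 1] and [c = -1], positivity of the squared length of [y + c p] bounds the product of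
     [y] and [p] by the mean of their squared lengths. *)
  assert (K : forall c, c * c = 1 -> 0 <= norm2 m y + 2 * c * dot m y p + norm2 m p).
  { intros c Hc. eapply Rle_trans; [apply (norm2_ge0 m (vadd y (vscale c p)))|].
    right. unfold norm2. rewrite dot_add_l, dot_scale_l, (dot_sym m y), (dot_sym m p (vadd _ _)).
    rewrite !dot_add_l, !dot_scale_l, (dot_sym m p y).
    replace (dot m p p) with (c * c * dot m p p) at 2 by (rewrite Hc; ring). ring. }
  pose proof (K 1). pose proof (K (-1)).
  assert (Rabs (dot m y p) <= (M + norm2 m p) / 2) by (apply Rabs_le; lra).
  nra.
Qed.

Lemma parallelogram_sym x y : parallelogram N x y -> parallelogram N y x.
Proof.
  unfold parallelogram. replace (vadd y x) with (vadd x y) by (vext; ring).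
  replace (vsub y x) with (vscale (-1) (vsub x y)) by (vext; ring).
  rewrite norm_scale2. lra.
Qed.

Lemma parallelogram_line c d x : parallelogram N (vscale c x) (vscale d x).
Proof.
  unfold parallelogram.
  replace (vadd (vscale c x) (vscale d x)) with (vscale (c + d) x) by (vext; ring).
  replace (vsub (vscale c x) (vscale d x)) with (vscale (c - d) x) by (vext; ring).
  rewrite !norm_scale2. ring.
Qed.

Lemma parallelogram_form Q x y : bilinear Q ->
  (forall c d, let w := vadd (vscale c x) (vscale d y) in N w ^ 2 = Q w w) -> parallelogram N x y.
Proof.
  intros HQ H. unfold parallelogram.
  replace (vadd x y) with (vadd (vscale 1 x) (vscale 1 y)) by (vext; ring).
  replace (vsub x y) with (vadd (vscale 1 x) (vscale (-1) y)) by (vext; ring).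
  replace (N x) with (N (vadd (vscale 1 x) (vscale 0 y))) by (f_equal; vext; ring).
  replace (N y) with (N (vadd (vscale 0 x) (vscale 1 y))) by (f_equal; vext; ring).
  rewrite !H. bil HQ. rewrite (bil_sym _ HQ y x). ring.
Qed.

(** * A single structure of revolution *)

Section Rev.
Context (a : vec) (P : vec -> vec -> R) (A : vec) (HP : revolution m N a P A).
Let HB := rev_bil _ _ _ _ _ HP.

Lemma rev_ge0 x : hyperplane m a x -> 0 <= P x x.
Proof.
  intros Hx. destruct (classic (x = vzero)) as [->|Hne].
  - replace vzero with (vscale 0 vzero) by (vext; ring). bil HB. lra.
  - pose proof (rev_pos _ _ _ _ _ HP x Hx Hne). lra.
Qed.

(** On the equator [N] depends on [P] alone, so by homogeneity [N ^ 2] is a constant multiple of [P]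
    there. *)
Lemma equator_parallelogram x y : hyperplane m a x -> hyperplane m a y ->
  P x A = 0 -> P y A = 0 -> parallelogram N x y.
Proof.
  intros Hx Hy Ex Ey. destruct (classic (x = vzero)) as [->|Hne].
  { replace vzero with (vscale 0 y) by (vext; ring). rewrite <- (vscale_1 y) at 2.
    apply parallelogram_line. }
  pose proof (rev_pos _ _ _ _ _ HP x Hx Hne) as Hpos.
  apply (parallelogram_form (fun u v => N x ^ 2 / P x x * P u v + 0 * (P u A * P v A))).
  { apply bilinear_combination; auto. }
  intros c d w. assert (Hw : hyperplane m a w) by (unfold w; hyp).
  pose proof (rev_ge0 w Hw) as Hw0.
  assert (0 <= P w w / P x x) by (apply Rle_mult_inv_pos; auto).
  rewrite (rev_inv _ _ _ _ _ HP w (vscale (sqrt (P w w / P x x)) x)).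
  - rewrite norm_scale2, pow2_sqrt by auto. field. lra.
  - auto.
  - hyp.
  - unfold w. bil HB. rewrite Ex, Ey. ring.
  - rewrite (bil_scale _ HB), (bil_scale_r _ HB).
    rewrite <- Rmult_assoc, sqrt_sqrt by auto. field. lra.
Qed.

(** Every [w] in [a^⊥] rotates to [c s + t A] with [t = P w A], and also, up to sign, to
    [c s - t A]. The parallelogram law for [c s] and [t A] therefore computes [N w ^ 2] from [N s]
    and [N A]. *)
Lemma axis_plane_form s : hyperplane m a s -> s <> vzero -> P s A = 0 ->
  (forall c d, parallelogram N (vscale c s) (vscale d A)) ->
  exists c d, forall w, hyperplane m a w -> N w ^ 2 = c * P w w + d * (P w A * P w A).
Proof.
  intros Hs Hne Es H.
  pose proof (rev_pos _ _ _ _ _ HP s Hs Hne) as Hpos.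
  pose proof (rev_axis _ _ _ _ _ HP) as HA.
  pose proof (rev_unit _ _ _ _ _ HP) as H1.
  exists (N s ^ 2 / P s s), (N A ^ 2 - N s ^ 2 / P s s). intros w Hw.
  assert (Hd : 0 <= P w w - P w A * P w A).
  { replace (P w w - P w A * P w A) with
      (P (vsub w (vscale (P w A) A)) (vsub w (vscale (P w A) A))).
    - apply rev_ge0. hyp.
    - bil HB. rewrite (bil_sym _ HB A w), H1. ring. }
  assert (Hq : 0 <= (P w w - P w A * P w A) / P s s) by (apply Rle_mult_inv_pos; auto).
  set (c := sqrt ((P w w - P w A * P w A) / P s s)).
  assert (Hc : c ^ 2 * P s s = P w w - P w A * P w A).
  { unfold c. rewrite pow2_sqrt by auto. field. lra. }
  specialize (H c (P w A)). unfold parallelogram in H.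
  assert (E1 : N w = N (vadd (vscale c s) (vscale (P w A) A))).
  { apply (rev_inv _ _ _ _ _ HP); [auto|hyp| |]; bil HB;
      rewrite ?(bil_sym _ HB A s), ?Es, H1; [ring|lra]. }
  assert (E2 : N w = N (vsub (vscale c s) (vscale (P w A) A))).
  { replace (N (vsub _ _)) with (N (vscale (-1) (vsub (vscale c s) (vscale (P w A) A)))).
    - apply (rev_inv _ _ _ _ _ HP); [auto|hyp| |]; bil HB;
      rewrite ?(bil_sym _ HB A s), ?Es, H1; [ring|lra].
    - rewrite (norm_scale _ _ HN), Rabs_left by lra. ring. }
  rewrite <- E1, <- E2, !norm_scale2 in H.
  replace (N s ^ 2 / P s s * P w w + (N A ^ 2 - N s ^ 2 / P s s) * (P w A * P w A))
    with (N s ^ 2 / P s s * (P w w - P w A * P w A) + N A ^ 2 * (P w A * P w A)) by ring.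
  rewrite <- Hc.
  replace (N s ^ 2 / P s s * (c ^ 2 * P s s)) with (c ^ 2 * N s ^ 2) by (field; lra). lra.
Qed.

Lemma rev_functional_bounded : exists C, 0 <= C /\ forall x, inR m x -> Rabs (P x A) <= C * N x.
Proof.
  destruct (functional_is_dot m (fun x => P x A)) as [p [_ Hp]].
  - intros; bil HB; auto.
  - intros; bil HB; auto.
  - destruct (dot_bounded p) as [C [HC H]]. exists C. split; auto.
    intros x Hx. rewrite Hp; auto.
Qed.
End Rev.

(** * Two structures of revolution on a common three-dimensional space *)

Definition comb3 (d b b' : vec) (x y z : R) : vec :=
  vadd (vscale x d) (vadd (vscale y b) (vscale z b')).

(** Translation into the coordinates of [two_axes_quadratic]: [d] lies on both equators, [b]
    completes it on the first and [b'] on the second, each orthogonal to [d] and of equal length for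
    the respective form. *)
Lemma two_revolutions_orthogonal a a' P P' A A' d b b' :
  revolution m N a P A -> revolution m N a' P' A' ->
  hyperplane m a d -> hyperplane m a b -> hyperplane m a b' ->
  hyperplane m a' d -> hyperplane m a' b -> hyperplane m a' b' ->
  d <> vzero ->
  P d A = 0 -> P b A = 0 -> P b' A <> 0 ->
  P' d A' = 0 -> P' b' A' = 0 -> P' b A' <> 0 ->
  P b d = 0 -> P b b = P d d -> P' b' d = 0 -> P' b' b' = P' d d ->
  exists p q c e, forall x y z,
    N (comb3 d b b' x y z) ^ 2 = c * ((x + p * z) ^ 2 + (y + q * z) ^ 2) + e * z ^ 2.
Proof.
  intros HP HP' Hd Hb Hb' Hd' Hb2 Hb2' Hne td tb tb' td' tb2' tb2 obd obb obd' obb'.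
  pose proof (rev_bil _ _ _ _ _ HP) as BP. pose proof (rev_bil _ _ _ _ _ HP') as BP'.
  pose proof (rev_pos _ _ _ _ _ HP d Hd Hne) as g0.
  pose proof (rev_pos _ _ _ _ _ HP' d Hd' Hne) as g0'.
  destruct (rev_functional_bounded _ _ _ HP) as [C1 [HC1 K1]].
  destruct (rev_functional_bounded _ _ _ HP') as [C2 [HC2 K2]].
  set (n := fun x y z => N (comb3 d b b' x y z)).
  assert (Hin : forall x y z, inR m (comb3 d b b' x y z)).
  { intros. apply (hyperplane_add m a _ _); hyp. }
  (* Since [d] and [b'] lie on the second equator, [P' v A'] is [y] times [P' b A']; likewise
     [P v A] recovers [z]. The bound on [x] follows by subtracting the other two components. *)
  assert (Hy : forall x y z, Rabs y <= C2 / Rabs (P' b A') * n x y z).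
  { intros. specialize (K2 _ (Hin x y z)). unfold comb3 at 1 in K2.
    rewrite !(bil_add _ BP'), !(bil_scale _ BP'), td', tb2', !Rmult_0_r, Rplus_0_l, Rplus_0_r,
      Rabs_mult in K2.
    apply Rabs_pos_lt in tb2. apply (Rmult_le_reg_r (Rabs (P' b A'))); auto.
    unfold n. eapply Rle_trans; [apply K2|]. right. field. lra. }
  assert (Hz : forall x y z, Rabs z <= C1 / Rabs (P b' A) * n x y z).
  { intros. specialize (K1 _ (Hin x y z)). unfold comb3 at 1 in K1.
    rewrite !(bil_add _ BP), !(bil_scale _ BP), td, tb, !Rmult_0_r, !Rplus_0_l,
      Rabs_mult in K1.
    apply Rabs_pos_lt in tb'. apply (Rmult_le_reg_r (Rabs (P b' A))); auto.
    unfold n. eapply Rle_trans; [apply K1|]. right. field. lra. }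
  set (Cy := C2 / Rabs (P' b A')) in *. set (Cz := C1 / Rabs (P b' A)) in *.
  assert (HCy : 0 <= Cy) by (apply Rle_mult_inv_pos; auto; apply Rabs_pos_lt; auto).
  assert (HCz : 0 <= Cz) by (apply Rle_mult_inv_pos; auto; apply Rabs_pos_lt; auto).
  assert (Nd : 0 < N d) by (apply norm_pos; auto; apply Hd).
  pose proof (norm_ge0 b) as Nb. pose proof (norm_ge0 b') as Nb'.
  assert (Hx : forall x y z, Rabs x <= (1 + Cy * N b + Cz * N b') / N d * n x y z).
  { intros x y z. specialize (Hy x y z). specialize (Hz x y z).
    apply (Rmult_le_reg_r (N d)); auto.
    replace ((1 + Cy * N b + Cz * N b') / N d * n x y z * N d)
      with (n x y z + Cy * n x y z * N b + Cz * n x y z * N b') by (field; lra).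
    rewrite <- (norm_scale _ _ HN).
    replace (vscale x d) with (vadd (comb3 d b b' x y z)
      (vadd (vscale (- y) b) (vscale (- z) b'))) by (unfold comb3; vext; ring).
    eapply Rle_trans; [apply (norm_add _ _ HN)|].
    pose proof (norm_add _ _ HN (vscale (- y) b) (vscale (- z) b')) as T.
    rewrite !(norm_scale _ _ HN), !Rabs_Ropp in T. unfold n in *. nra. }
  set (Cx := (1 + Cy * N b + Cz * N b') / N d) in *.
  assert (HCx : 0 <= Cx) by (apply Rle_mult_inv_pos; auto; nonneg).
  assert (Hn : forall x y z, 0 <= n x y z) by (intros; apply norm_ge0).
  clearbody Cx Cy Cz.
  (* [p] and [q] are the coordinates of the [P]-orthogonal projection of [b'] to the span of [d] and
     [b]; [p'] and [q'] those of the [P']-orthogonal projection of [b] to the span of [d] and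
     [b']. *)
  set (p := P b' d / P d d). set (q := P b' b / P d d).
  set (p' := P' b d / P' d d). set (q' := P' b b' / P' d d).
  exists p, q.
  apply (two_axes_quadratic n p q p' q' (Cy + Cx)).
  - intros. unfold n. rewrite <- (norm_scale _ _ HN). f_equal. unfold comb3. vext. ring.
  - intros. unfold n. eapply Rle_trans; [|apply (norm_add _ _ HN)]. right. f_equal.
    unfold comb3. vext. ring.
  - intros. specialize (Hx x y z). pose proof (Rmult_le_pos _ _ HCy (Hn x y z)). lra.
  - intros. specialize (Hy x y z). pose proof (Rmult_le_pos _ _ HCx (Hn x y z)). lra.
  - intros x y z x' y' E. unfold n, comb3. apply (rev_inv _ _ _ _ _ HP); [hyp|hyp| |].
    + bil BP. rewrite td, tb. ring.
    + assert (F : forall x y, P (comb3 d b b' x y z) (comb3 d b b' x y z) =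
        P d d * ((x + p * z) ^ 2 + (y + q * z) ^ 2)
        + z ^ 2 * (P b' b' - P d d * p ^ 2 - P d d * q ^ 2)).
      { intros. unfold comb3. bil BP.
        rewrite (bil_sym _ BP d b), (bil_sym _ BP d b'), (bil_sym _ BP b b'), obd, obb.
        unfold p, q. field. lra. }
      fold (comb3 d b b' x y z) (comb3 d b b' x' y' z). rewrite !F, E. ring.
  - intros x y z x' z' E. unfold n, comb3. apply (rev_inv _ _ _ _ _ HP'); [hyp|hyp| |].
    + bil BP'. rewrite td', tb2'. ring.
    + assert (F : forall x z, P' (comb3 d b b' x y z) (comb3 d b b' x y z) =
        P' d d * ((x + p' * y) ^ 2 + (z + q' * y) ^ 2)
        + y ^ 2 * (P' b b - P' d d * p' ^ 2 - P' d d * q' ^ 2)).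
      { intros. unfold comb3. bil BP'.
        rewrite (bil_sym _ BP' d b), (bil_sym _ BP' d b'), (bil_sym _ BP' b' b), obd', obb'.
        unfold p', q'. field. lra. }
      fold (comb3 d b b' x y z) (comb3 d b b' x' y z'). rewrite !F, E. ring.
Qed.

(** Gram-Schmidt inside the equator. The result is given by coefficients with [c <> 0], so that the
    change of basis can be inverted. *)
Lemma orthogonalize a P A d h : revolution m N a P A ->
  hyperplane m a d -> hyperplane m a h -> d <> vzero -> P d A = 0 -> P h A = 0 ->
  (forall c, h <> vscale c d) ->
  exists c e, c <> 0 /\ let b := vadd (vscale c h) (vscale e d) in
    P b d = 0 /\ P b b = P d d.
Proof.
  intros HP Hd Hh Hne td th Hind.
  pose proof (rev_bil _ _ _ _ _ HP) as BP.
  pose proof (rev_pos _ _ _ _ _ HP d Hd Hne) as g0.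
  set (h0 := vadd h (vscale (- (P h d / P d d)) d)).
  assert (H0 : 0 < P h0 h0).
  { apply (rev_pos _ _ _ _ _ HP); [unfold h0; hyp|]. intros E.
    apply (Hind (P h d / P d d)). apply functional_extensionality; intro i.
    apply (f_equal (fun v => v i)) in E. unfold h0, vadd, vscale, vzero in *. lra. }
  assert (O : P h0 d = 0) by (unfold h0; bil BP; field; lra).
  set (c := sqrt (P d d / P h0 h0)).
  assert (Hq : 0 < P d d / P h0 h0) by (apply Rdiv_lt_0_compat; auto).
  exists c, (c * (- (P h d / P d d))). split.
  - pose proof (sqrt_lt_R0 _ Hq). unfold c. lra.
  - replace (vadd _ _) with (vscale c h0) by (unfold h0; vext; ring).
    intros b. unfold b. bil BP. rewrite O. split; [ring|].
    rewrite <- Rmult_assoc. unfold c. rewrite sqrt_sqrt by lra. field. lra.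
Qed.

(** Orthogonalizing [h] and [h'] against [d] reduces to the normalized basis, where [N ^ 2] is a
    quadratic polynomial in the coordinates. *)
Lemma two_revolutions_parallelogram a a' P P' A A' d h h' :
  revolution m N a P A -> revolution m N a' P' A' ->
  hyperplane m a d -> hyperplane m a h -> hyperplane m a h' ->
  hyperplane m a' d -> hyperplane m a' h -> hyperplane m a' h' ->
  d <> vzero ->
  P d A = 0 -> P h A = 0 -> P h' A <> 0 ->
  P' d A' = 0 -> P' h' A' = 0 -> P' h A' <> 0 ->
  forall x y z x' y' z', parallelogram N (comb3 d h h' x y z) (comb3 d h h' x' y' z').
Proof.
  intros HP HP' Hd Hb Hb' Hd' Hb2 Hb2' Hne td tb tb' td' tb2' tb2.
  pose proof (rev_bil _ _ _ _ _ HP) as BP. pose proof (rev_bil _ _ _ _ _ HP') as BP'.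
  destruct (orthogonalize a P A d h) as [c [e [Hc [O1 O2]]]]; auto.
  { intros k ->. apply tb2. bil BP'. rewrite td'. ring. }
  destruct (orthogonalize a' P' A' d h') as [c' [e' [Hc' [O1' O2']]]]; auto.
  { intros k ->. apply tb'. bil BP. rewrite td. ring. }
  set (b := vadd (vscale c h) (vscale e d)) in *.
  set (b' := vadd (vscale c' h') (vscale e' d)) in *.
  destruct (two_revolutions_orthogonal a a' P P' A A' d b b') as [p [q [k [l H]]]]; auto;
    try (unfold b, b'; hyp; fail).
  - unfold b. bil BP. rewrite tb, td. ring.
  - unfold b'. bil BP. rewrite td. intros E. apply tb'. nra.
  - unfold b'. bil BP'. rewrite tb2', td'. ring.
  - unfold b. bil BP'. rewrite td'. intros E. apply tb2. nra.
  - assert (F : forall x y z, comb3 d h h' x y z =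
      comb3 d b b' (x - y * e / c - z * e' / c') (y / c) (z / c')).
    { intros. unfold comb3, b, b'. vext. field. auto. }
    intros. rewrite !F. unfold parallelogram.
    replace (vadd (comb3 d b b' _ _ _) (comb3 d b b' _ _ _)) with
      (comb3 d b b' (x - y * e / c - z * e' / c' + (x' - y' * e / c - z' * e' / c'))
        (y / c + y' / c) (z / c' + z' / c')) by (unfold comb3; vext; ring).
    replace (vsub (comb3 d b b' _ _ _) (comb3 d b b' _ _ _)) with
      (comb3 d b b' (x - y * e / c - z * e' / c' - (x' - y' * e / c - z' * e' / c'))
        (y / c - y' / c) (z / c' - z' / c')) by (unfold comb3; vext; ring).
    rewrite !H. ring.
Qed.
End Norm.

(** * Poles *)

Ltac splits := repeat match goal with |- _ /\ _ => split end.

Lemma hyperplane_through m l : (length l < m)%nat -> (forall v, In v l -> inR m v) ->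
  exists a, nonzero_vec m a /\ forall v, In v l -> hyperplane m a v.
Proof.
  intros Hl Hin. destruct (exists_orthogonal m l Hl) as [a [Ha H]].
  exists a. split; auto. intros v Hv. split; auto.
Qed.

Section Poles.
Context (m : nat) (N : vec -> R) (Hm : (5 <= m)%nat) (HN : is_norm m N).

Section Pair.
Context (a a' : vec) (P P' : vec -> vec -> R) (A A' : vec)
  (HP : revolution m N a P A) (HP' : revolution m N a' P' A').
Let BP := rev_bil _ _ _ _ _ HP.
Let BP' := rev_bil _ _ _ _ _ HP'.

(** If proportionality failed, the plane of [x, y] would meet the two equators in distinct lines,
    spanned by [h] and [h']. Some nonzero [d] lies on both equators, being orthogonal to only four
    vectors in dimension at least 5, and the law would hold on the span of [d, h, h'], which
    contains [x] and [y]. *)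
Lemma proportional_on_pair x y :
  hyperplane m a x -> hyperplane m a y -> hyperplane m a' x -> hyperplane m a' y ->
  ~ parallelogram N x y -> P x A * P' y A' = P y A * P' x A'.
Proof.
  intros Hx Hy Hx' Hy' Hxy. apply NNPP. intros HD.
  destruct (functional_is_dot m (fun v => P v A)) as [p [_ Hp]];
    [intros; bil BP; auto|intros; bil BP; auto|].
  destruct (functional_is_dot m (fun v => P' v A')) as [p' [_ Hp']];
    [intros; bil BP'; auto|intros; bil BP'; auto|].
  destruct (exists_orthogonal m (a :: a' :: p :: p' :: nil)) as [d [Hd Ho]]; [simpl; lia|].
  apply nonzero_vec_neq in Hd. destruct Hd as [Hd Hne].
  set (D := P x A * P' y A' - P y A * P' x A').
  assert (HD0 : D <> 0) by (unfold D; lra).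
  apply Hxy.
  set (h := vsub (vscale (P y A) x) (vscale (P x A) y)).
  set (h' := vsub (vscale (P' y A') x) (vscale (P' x A') y)).
  (* Cramer's rule with determinant [D] expresses [x] and [y] through [h] and [h']. *)
  replace x with (comb3 d h h' 0 (- (P' x A' / D)) (P x A / D))
    by (unfold comb3, h, h'; vext; unfold D in *; field; auto).
  replace y with (comb3 d h h' 0 (- (P' y A' / D)) (P y A / D))
    by (unfold comb3, h, h'; vext; unfold D in *; field; auto).
  apply (two_revolutions_parallelogram m N HN a a' P P' A A' d h h'); auto;
    try (unfold h, h'; hyp; fail).
  - split; auto. rewrite dot_sym. apply Ho; simpl; auto.
  - split; auto. rewrite dot_sym. apply Ho; simpl; auto.
  - rewrite Hp by auto. rewrite dot_sym. apply Ho; simpl; auto.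
  - unfold h. bil BP. ring.
  - unfold h'. bil BP. unfold D in HD0. lra.
  - rewrite Hp' by auto. rewrite dot_sym. apply Ho; simpl; auto.
  - unfold h'. bil BP'. ring.
  - unfold h. bil BP'. unfold D in HD0. lra.
Qed.

(** By [proportional_on_pair] the combination [d] of [x] and [y] lies on both equators. If
    proportionality failed at [z], shifting [z] along [x] onto each equator would give [h] and [h']
    with [h - h' = k x] and [k <> 0]; the span of [d, h, h'] contains [x] and [y], so the law would
    hold for them. *)
Lemma proportional_from x y z :
  hyperplane m a x -> hyperplane m a y -> hyperplane m a' x -> hyperplane m a' y ->
  hyperplane m a z -> hyperplane m a' z ->
  ~ parallelogram N x y -> P x A <> 0 -> P' x A' <> 0 /\ P x A * P' z A' = P z A * P' x A'.
Proof.
  intros Hx Hy Hx' Hy' Hz Hz' Hxy Hnz.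
  pose proof (proportional_on_pair x y Hx Hy Hx' Hy' Hxy) as E.
  assert (Hnz' : P' x A' <> 0).
  { intros E'. apply Hxy. apply (equator_parallelogram m N HN a' P' A' HP'); auto.
    rewrite E' in E. nra. }
  split; auto.
  apply NNPP. intros HD. apply Hxy.
  set (d := vsub (vscale (P y A) x) (vscale (P x A) y)).
  set (h := vsub z (vscale (P z A / P x A) x)).
  set (h' := vsub z (vscale (P' z A' / P' x A') x)).
  set (k := P' z A' / P' x A' - P z A / P x A).
  assert (Hk : k <> 0).
  { intros K. apply HD. apply Rminus_diag_uniq.
    replace (P x A * P' z A' - P z A * P' x A') with (k * (P x A * P' x A'))
      by (unfold k; field; auto). rewrite K. ring. }
  replace x with (comb3 d h h' 0 (/ k) (- / k)) at 1.
  2: { unfold comb3, h, h'. vext. unfold k in *. field.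
       repeat split; auto. intros F. apply HD. lra. }
  replace y with (comb3 d h h' (- / P x A) (P y A / P x A / k) (- (P y A / P x A / k))).
  2: { unfold comb3, h, h', d. vext. unfold k in *. field.
       repeat split; auto. intros F. apply HD. lra. }
  apply (two_revolutions_parallelogram m N HN a a' P P' A A' d h h'); auto;
    try (unfold d, h, h'; hyp; fail).
  - intros E0. apply Hxy. rewrite <- (vscale_1 x).
    replace y with (vscale (P y A / P x A) x); [apply (parallelogram_line m N HN)|].
    apply functional_extensionality; intro i. apply (f_equal (fun v => v i)) in E0.
    unfold d, vsub, vscale, vzero in *. apply (Rmult_eq_reg_l (P x A)); auto.
    transitivity (P y A * x i); [field; auto|lra].
  - unfold d. bil BP. ring.
  - unfold h. bil BP. field; auto.
  - unfold h'. bil BP. intros E0. apply Hk.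
    apply (Rmult_eq_reg_l (P x A)); auto. rewrite Rmult_0_r, <- Ropp_0, <- E0. unfold k. field; auto.
  - unfold d. bil BP'. lra.
  - unfold h'. bil BP'. field; auto.
  - unfold h. bil BP'. intros E0. apply Hk.
    apply (Rmult_eq_reg_l (P' x A')); auto. rewrite Rmult_0_r, <- E0. unfold k. field; auto.
Qed.
End Pair.

Context (hrev : forall a, nonzero_vec m a -> exists P A, revolution m N a P A).

(** The vector [p] represents the linear form [z -> P z A / P e A], the same for all hyperplanes
    through [x] and [y]. Its kernel contains all their equators, and [e] is the member of the pair
    used for normalization. *)
Record pole (x y e p : vec) : Prop := {
  pole_mem : e = x \/ e = y;
  pole_inR : inR m p;
  pole_unit : dot m e p = 1;
  pole_spec : forall a P A, revolution m N a P A -> hyperplane m a x -> hyperplane m a y ->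
    P e A <> 0 /\ forall z, hyperplane m a z -> P z A = P e A * dot m z p }.

Lemma exists_pole_at x y a P A : inR m x -> inR m y -> ~ parallelogram N x y ->
  revolution m N a P A -> hyperplane m a x -> hyperplane m a y -> P x A <> 0 ->
  exists p, pole x y x p.
Proof.
  intros Hx Hy Hxy HP Hax Hay Hnz.
  assert (U : forall a' P' A', revolution m N a' P' A' ->
    hyperplane m a' x -> hyperplane m a' y -> P' x A' <> 0).
  { intros a' P' A' HP' Hx' Hy'.
    apply (proportional_from a a' P P' A A' HP HP' x y x); auto. }
  (* [r] is the value of [P z A / P x A] in some hyperplane through [x, y, z]; it is independent of
     the choice by [proportional_from]. *)
  set (val := fun z r => exists a P A, revolution m N a P A /\ hyperplane m a x /\
    hyperplane m a y /\ hyperplane m a z /\ P z A = P x A * r).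
  assert (Vex : forall z, inR m z -> exists r, val z r).
  { intros z Hz. destruct (hyperplane_through m (x :: y :: z :: nil)) as [b [Hb Hin]].
    - simpl; lia.
    - simpl. intuition; subst; auto.
    - destruct (hrev b Hb) as [Q [Bx HQ]].
      assert (Q x Bx <> 0) by (apply (U b); auto; apply Hin; simpl; auto).
      exists (Q z Bx / Q x Bx), b, Q, Bx.
      splits; auto; try (apply Hin; simpl; auto; fail). field; auto. }
  assert (Vun : forall b Q Bx z r, revolution m N b Q Bx -> hyperplane m b x ->
    hyperplane m b y -> hyperplane m b z -> val z r -> Q z Bx = Q x Bx * r).
  { intros b Q Bx z r HQ Hbx Hby Hbz [c [T [Cx [HT [Hcx [Hcy [Hcz E]]]]]]].
    pose proof (U _ _ _ HQ Hbx Hby) as H1. pose proof (U _ _ _ HT Hcx Hcy) as H2.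
    destruct (proportional_from b c Q T Bx Cx HQ HT x y z) as [_ E2]; auto.
    rewrite E in E2. apply (Rmult_eq_reg_r (T x Cx)); auto. rewrite <- E2. ring. }
  set (L := fun z => epsilon (inhabits 0) (val z)).
  assert (HL : forall z, inR m z -> val z (L z)).
  { intros z Hz. apply epsilon_spec, Vex; auto. }
  assert (HLe : forall b Q Bx z, revolution m N b Q Bx -> hyperplane m b x ->
    hyperplane m b y -> hyperplane m b z -> Q z Bx = Q x Bx * L z).
  { intros b Q Bx z HQ Hbx Hby Hbz. apply (Vun b); auto. apply HL. apply Hbz. }
  (* Linearity is checked inside one hyperplane through four vectors, which exists because
     [m >= 5]. *)
  assert (two : forall z z', inR m z -> inR m z' -> exists b Q Bx, revolution m N b Q Bx /\
    hyperplane m b x /\ hyperplane m b y /\ hyperplane m b z /\ hyperplane m b z').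
  { intros z z' Hz Hz'.
    destruct (hyperplane_through m (x :: y :: z :: z' :: nil)) as [b [Hb Hin]].
    - simpl; lia.
    - simpl. intuition; subst; auto.
    - destruct (hrev b Hb) as [Q [Bx HQ]]. exists b, Q, Bx.
      splits; auto; apply Hin; simpl; auto. }
  destruct (functional_is_dot m L) as [p [Hp HpL]].
  - intros z z' Hz Hz'. destruct (two z z' Hz Hz') as [b [Q [Bx [HQ [Hbx [Hby [Hbz Hbz']]]]]]].
    apply (Rmult_eq_reg_l (Q x Bx)); [|apply (U b); auto].
    rewrite Rmult_plus_distr_l, <- !(HLe b Q Bx) by (auto; hyp).
    bil (rev_bil _ _ _ _ _ HQ). auto.
  - intros c z Hz. destruct (two z z Hz Hz) as [b [Q [Bx [HQ [Hbx [Hby [Hbz _]]]]]]].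
    apply (Rmult_eq_reg_l (Q x Bx)); [|apply (U b); auto].
    replace (Q x Bx * (c * L z)) with (c * (Q x Bx * L z)) by ring.
    rewrite <- !(HLe b Q Bx) by (auto; hyp).
    bil (rev_bil _ _ _ _ _ HQ). auto.
  - exists p. split; auto.
    + rewrite <- HpL by auto. apply (Rmult_eq_reg_l (P x A)); auto.
      rewrite <- (HLe a) by auto. ring.
    + intros b Q Bx HQ Hbx Hby. split; [apply (U b); auto|].
      intros z Hz. rewrite <- HpL by apply Hz. apply (HLe b); auto.
Qed.

(** The two vectors cannot both lie on the equator, where the law holds; one that does not serves
    for normalization. *)
Lemma exists_pole x y : inR m x -> inR m y -> ~ parallelogram N x y ->
  exists e p, pole x y e p.
Proof.
  intros Hx Hy Hxy.
  destruct (hyperplane_through m (x :: y :: nil)) as [a [Ha Hin]].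
  - simpl; lia.
  - simpl. intuition; subst; auto.
  - destruct (hrev a Ha) as [P [A HP]].
    assert (Hax : hyperplane m a x) by (apply Hin; simpl; auto).
    assert (Hay : hyperplane m a y) by (apply Hin; simpl; auto).
    destruct (Req_dec (P x A) 0) as [E|E].
    + destruct (Req_dec (P y A) 0) as [E'|E'].
      { elim Hxy. apply (equator_parallelogram m N HN a P A HP); auto. }
      destruct (exists_pole_at y x a P A) as [p Hp]; auto.
      { intros H. apply Hxy, (parallelogram_sym m N HN); auto. }
      exists y, p. destruct Hp. split; auto.
    + destruct (exists_pole_at x y a P A) as [p Hp]; auto.
      exists x, p; auto.
Qed.

(** [k] may be zero, so this relation is not symmetric by definition; [axis_pair] therefore supplies
    both directions. *)
Definition same_pole (p p' : vec) : Prop :=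
  exists k, forall z, inR m z -> dot m z p' = k * dot m z p.

Lemma same_pole_trans p1 p2 p3 : same_pole p1 p2 -> same_pole p2 p3 -> same_pole p1 p3.
Proof.
  intros [k Hk] [l Hl]. exists (l * k). intros z Hz. rewrite Hl, Hk; auto. ring.
Qed.

(** In a hyperplane through both pairs and [z], each pole computes [P z A] up to a nonzero factor.
    Taking [z = e], where [p] has value 1, identifies the constant as [dot m e p']. *)
Lemma linked_same_pole x y e p x' y' e' p' : pole x y e p -> pole x' y' e' p' ->
  (forall z, inR m z -> exists a, nonzero_vec m a /\
     (hyperplane m a x /\ hyperplane m a y /\ hyperplane m a x' /\ hyperplane m a y') /\
     hyperplane m a z) ->
  same_pole p p'.
Proof.
  intros H H' Hl. exists (dot m e p'). intros z Hz.
  destruct (Hl z Hz) as [a [Ha [[Hx [Hy [Hx' Hy']]] Haz]]].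
  destruct (hrev a Ha) as [P [A HP]].
  destruct (pole_spec _ _ _ _ H a P A HP Hx Hy) as [H1 H2].
  destruct (pole_spec _ _ _ _ H' a P A HP Hx' Hy') as [H1' H2'].
  assert (He : hyperplane m a e) by (destruct (pole_mem _ _ _ _ H); subst; auto).
  pose proof (H2 z Haz) as E1. rewrite (H2' z Haz), (H2' e He) in E1.
  apply (Rmult_eq_reg_l (P e' A)); auto. rewrite E1. ring.
Qed.

Lemma same_pole_of_span x y e p x' y' e' p' u v w :
  pole x y e p -> pole x' y' e' p' -> inR m u -> inR m v -> inR m w ->
  (forall a, hyperplane m a u -> hyperplane m a v -> hyperplane m a w ->
    hyperplane m a x /\ hyperplane m a y /\ hyperplane m a x' /\ hyperplane m a y') ->
  same_pole p p'.
Proof.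
  intros H H' Hu Hv Hw Hs. apply (linked_same_pole x y e p x' y' e' p'); auto.
  intros z Hz. destruct (hyperplane_through m (u :: v :: w :: z :: nil)) as [a [Ha Hin]].
  - simpl; lia.
  - simpl. intuition; subst; auto.
  - exists a. split; auto. split; [apply Hs|]; apply Hin; simpl; auto.
Qed.

(** Exchanges a failing pair in [a^⊥] for one in a plane through the axis. Both pairs lie in the
    span of [x, y, A], so their poles are proportional. *)
Lemma axis_pair a P A x y e p : revolution m N a P A -> hyperplane m a x -> hyperplane m a y ->
  ~ parallelogram N x y -> pole x y e p ->
  exists s c d f q, hyperplane m a s /\ pole (vscale c s) (vscale d A) f q /\
    same_pole p q /\ same_pole q p.
Proof.
  intros HP Hx Hy Hxy Hp. pose proof (rev_bil _ _ _ _ _ HP) as BP.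
  pose proof (rev_axis _ _ _ _ _ HP) as HA. pose proof (rev_unit _ _ _ _ _ HP) as H1.
  assert (Hs : exists s, (s = x \/ s = y) /\ vsub s (vscale (P s A) A) <> vzero).
  { apply NNPP. intros Hno. apply Hxy.
    assert (K : forall s, s = x \/ s = y -> s = vscale (P s A) A).
    { intros s Hs. apply NNPP. intros Hne. apply Hno. exists s. split; auto. intros E.
      apply Hne. apply functional_extensionality; intro i.
      apply (f_equal (fun v => v i)) in E. unfold vsub, vzero in E. lra. }
    rewrite (K x), (K y) by auto. apply (parallelogram_line m N HN). }
  destruct Hs as [s [Hs Hne]].
  assert (Has : hyperplane m a s) by (destruct Hs; subst; auto).
  set (s0 := vsub s (vscale (P s A) A)) in *.
  assert (Hs0 : hyperplane m a s0) by (unfold s0; hyp).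
  (* If every such pair obeyed the law, [axis_plane_form] would make [N ^ 2] quadratic on [a^⊥], and
     [x, y] would obey it too. *)
  assert (Hex : exists c d, ~ parallelogram N (vscale c s0) (vscale d A)).
  { apply NNPP. intros Hno. apply Hxy.
    destruct (axis_plane_form m N HN a P A HP s0) as [c [d Hf]]; auto.
    - unfold s0. bil BP. rewrite H1. ring.
    - intros c d. apply NNPP. intros Hn. apply Hno. eauto.
    - apply (parallelogram_form N (fun u v => c * P u v + d * (P u A * P v A))).
      + apply bilinear_combination; auto.
      + intros. apply Hf. unfold w; hyp. }
  destruct Hex as [c [d Hcd]].
  destruct (exists_pole (vscale c s0) (vscale d A)) as [f [q Hq]]; auto;
    try (apply inR_scale; (apply Hs0 || apply HA)).
  exists s0, c, d, f, q.
  assert (Hspan : forall b, hyperplane m b x -> hyperplane m b y -> hyperplane m b A ->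
    hyperplane m b (vscale c s0) /\ hyperplane m b (vscale d A)).
  { intros b Hbx Hby HbA. split; [|hyp]. unfold s0. destruct Hs; subst; hyp. }
  assert (inR m x) by apply Hx. assert (inR m y) by apply Hy. assert (inR m A) by apply HA.
  splits; auto.
  - apply (same_pole_of_span x y e p _ _ f q x y A Hp Hq); auto.
  - apply (same_pole_of_span _ _ f q x y e p x y A Hq Hp); auto.
    intros b Hbx Hby HbA. destruct (Hspan b); auto.
Qed.

(** Inside a hyperplane through all four vectors, both pairs are exchanged for pairs in planes
    through its axis. The two new planes share [A], so together they span at most three
    dimensions. *)
Lemma all_same_pole x y e p x' y' e' p' :
  inR m x -> inR m y -> inR m x' -> inR m y' ->
  ~ parallelogram N x y -> ~ parallelogram N x' y' ->
  pole x y e p -> pole x' y' e' p' -> same_pole p p'.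
Proof.
  intros Hx Hy Hx' Hy' Hxy Hxy' Hp Hp'.
  destruct (hyperplane_through m (x :: y :: x' :: y' :: nil)) as [a [Ha Hin]].
  - simpl; lia.
  - simpl. intuition; subst; auto.
  - destruct (hrev a Ha) as [P [A HP]].
    destruct (axis_pair a P A x y e p) as [s [c [d [f [q [Hs [Hq [S1 _]]]]]]]];
      try (apply Hin; simpl); auto.
    destruct (axis_pair a P A x' y' e' p') as [s' [c' [d' [f' [q' [Hs' [Hq' [_ S2]]]]]]]];
      try (apply Hin; simpl); auto.
    apply (same_pole_trans p q p'); auto. apply (same_pole_trans q q' p'); auto.
    apply (same_pole_of_span _ _ _ _ _ _ _ _ s s' A Hq Hq').
    + apply Hs.
    + apply Hs'.
    + apply (rev_axis _ _ _ _ _ HP).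
    + intros b H1 H2 H3. splits; hyp.
Qed.

Lemma some_section_parallelogram : exists a, nonzero_vec m a /\
  forall x y, hyperplane m a x -> hyperplane m a y -> parallelogram N x y.
Proof.
  apply NNPP. intros Hno.
  assert (H : forall a, nonzero_vec m a -> exists x y, hyperplane m a x /\ hyperplane m a y /\
    ~ parallelogram N x y).
  { intros a Ha. apply NNPP. intros Hn. apply Hno. exists a. split; auto.
    intros x y Hx Hy. apply NNPP. intros Hxy. apply Hn. eauto. }
  destruct (H (delta 0)) as [x [y [Hx [Hy Hxy]]]].
  { split; [apply inR_delta; lia|]. exists 0%nat. split; [lia|]. rewrite delta_self. lra. }
  destruct (exists_pole x y) as [e [p Hp]]; auto; try apply Hx; try apply Hy.
  (* The hyperplane orthogonal to the pole [p] is used: the pole of its failing pair is proportional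
     to [p], hence vanishes on [e'], where it should be 1. *)
  destruct (H p) as [x' [y' [Hx' [Hy' Hxy']]]].
  { apply nonzero_vec_neq. split; [apply Hp|]. intros E.
    pose proof (pole_unit _ _ _ _ Hp) as U. rewrite E in U.
    unfold dot in U. rewrite sumR_zero in U; [lra|]. intros; unfold vzero; ring. }
  destruct (exists_pole x' y') as [e' [p' Hp']]; auto; try apply Hx'; try apply Hy'.
  assert (S : same_pole p p').
  { apply (all_same_pole x y e p x' y' e' p'); auto; (apply Hx || apply Hy || apply Hx' || apply Hy'). }
  destruct S as [k Hk].
  assert (He : hyperplane m p e') by (destruct (pole_mem _ _ _ _ Hp'); subst; auto).
  pose proof (pole_unit _ _ _ _ Hp') as U. rewrite Hk in U by apply He.
  destruct He as [_ He]. rewrite He in U. lra.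
Qed.
End Poles.

(** * The gauge of a symmetric convex body *)

Definition trunc (m : nat) (x : vec) : vec :=
  fun i => if Compare_dec.lt_dec i m then x i else 0.

Lemma trunc_inR m x : inR m (trunc m x).
Proof. intros i Hi. unfold trunc. destruct Compare_dec.lt_dec; auto; lia. Qed.

Lemma trunc_id m x : inR m x -> trunc m x = x.
Proof.
  intros Hx. apply functional_extensionality; intro i. unfold trunc.
  destruct Compare_dec.lt_dec; auto. rewrite Hx; auto; lia.
Qed.

Lemma trunc_add m x y : trunc m (vadd x y) = vadd (trunc m x) (trunc m y).
Proof. vext. unfold trunc. destruct Compare_dec.lt_dec; ring. Qed.

Lemma trunc_scale m c x : trunc m (vscale c x) = vscale c (trunc m x).
Proof. vext. unfold trunc. destruct Compare_dec.lt_dec; ring. Qed.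

Lemma trunc_apply m x i : (i < m)%nat -> trunc m x i = x i.
Proof. intros. unfold trunc. destruct Compare_dec.lt_dec; auto; lia. Qed.

Lemma inR_vzero m : inR m vzero.
Proof. intros i Hi; auto. Qed.

Lemma norm2_scale m c x : norm2 m (vscale c x) = c ^ 2 * norm2 m x.
Proof.
  unfold norm2. rewrite dot_scale_l, (dot_sym m x), dot_scale_l. ring.
Qed.

Lemma norm2_ext m x y : (forall i, (i < m)%nat -> x i = y i) -> norm2 m x = norm2 m y.
Proof. intros H. apply sumR_ext. intros i Hi. rewrite H; auto. Qed.

Lemma dot_bilinear m : bilinear (dot m).
Proof. split; [apply dot_add_l|apply dot_scale_l|apply dot_sym]. Qed.

Lemma cv_constant c : Un_cv (fun _ => c) c.
Proof.
  intros eps He. exists 0%nat. intros n _. unfold R_dist, Rdist.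
  rewrite Rminus_diag, Rabs_R0. auto.
Qed.

Section Gauge.
Context (m : nat) (K : vec -> Prop) (HK : sym_convex_body m K).

(** By symmetry the body contains [x + y] and [y - x], whose midpoint is [y]. The centre [x] is
    truncated because its coordinates beyond [m] are unconstrained. *)
Lemma body_contains_ball : exists r, 0 < r /\ forall y, inR m y -> norm2 m y < r * r -> K y.
Proof.
  destruct HK as [_ [Hc [_ [_ [[x [r [Hr Hball]]] Hs]]]]].
  exists r. split; auto. intros y Hy Hny.
  assert (H1 : K (vadd (trunc m x) y)).
  { apply Hball; [apply inR_add; auto; apply trunc_inR|].
    rewrite (norm2_ext m _ y); auto. intros i Hi. unfold vsub, vadd.
    rewrite trunc_apply by auto. ring. }
  assert (H2 : K (vsub y (trunc m x))).
  { replace (vsub y (trunc m x)) with (vopp (vadd (trunc m x) (vscale (-1) y))) by (vext; ring).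
    apply Hs, Hball; [apply inR_add; [apply trunc_inR|apply inR_scale; auto]|].
    rewrite (norm2_ext m _ (vscale (-1) y)).
    - rewrite norm2_scale. lra.
    - intros i Hi. unfold vsub, vadd. rewrite trunc_apply by auto. ring. }
  replace y with (vadd (vscale (1 / 2) (vadd (trunc m x) y))
    (vscale (1 - 1 / 2) (vsub y (trunc m x)))) by (vext; field).
  apply Hc; auto; lra.
Qed.

Lemma body_zero : K vzero.
Proof.
  destruct body_contains_ball as [r [Hr H]]. apply H; [apply inR_vzero|].
  unfold norm2, dot. rewrite sumR_zero; [nra|]. intros; unfold vzero; ring.
Qed.

Lemma body_shrink x t : K x -> 0 <= t <= 1 -> K (vscale t x).
Proof.
  intros Hx Ht. replace (vscale t x) with (vadd (vscale t x) (vscale (1 - t) vzero)) by (vext; ring).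
  apply HK; auto. apply body_zero.
Qed.

(** For [x <> 0] take [r = 1 / S], with [S] the largest multiple of [x] in the body: finite by
    boundedness, positive by the inner ball. *)
Lemma gauge_exists x : inR m x ->
  exists r, 0 <= r /\ forall s, K (vscale s x) <-> Rabs s * r <= 1.
Proof.
  intros Hx. destruct (classic (x = vzero)) as [->|Hne].
  { exists 0. split; [lra|]. intros s. rewrite Rmult_0_r. split; [lra|]. intros _.
    replace (vscale s vzero) with vzero by (vext; ring). apply body_zero. }
  assert (Hn : 0 < norm2 m x) by (apply nonzero_vec_norm2, nonzero_vec_neq; auto).
  set (E := fun s => K (vscale s x)).
  destruct (completeness E) as [S [HS1 HS2]].
  { destruct HK as [_ [_ [[M HM] _]]]. exists (M / norm2 m x + 1). intros s Hs.
    specialize (HM _ Hs). rewrite norm2_scale in HM.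
    assert (s ^ 2 <= M / norm2 m x).
    { apply (Rmult_le_reg_r (norm2 m x)); auto. unfold Rdiv.
      rewrite Rmult_assoc, Rinv_l by lra. lra. }
    nra. }
  { exists 0. unfold E. replace (vscale 0 x) with vzero by (vext; ring). apply body_zero. }
  assert (S0 : 0 < S).
  { destruct body_contains_ball as [r [Hr H]].
    set (s := r / (1 + norm2 m x)).
    assert (Hs : 0 < s) by (apply Rdiv_lt_0_compat; lra).
    assert (E s).
    { apply H; [apply inR_scale; auto|]. rewrite norm2_scale.
      assert (Er : r = s * (1 + norm2 m x)) by (unfold s; field; lra).
      rewrite Er. assert (0 < s * s) by nra. nra. }
    specialize (HS1 s H0). lra. }
  assert (below : forall s, 0 <= s < S -> E s).
  { intros s Hs. apply NNPP. intros Hno.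
    assert (S <= s); [|lra]. apply HS2. intros s' Hs'.
    destruct (Rle_dec s' s) as [|Hgt]; auto. elim Hno. apply Rnot_le_lt in Hgt.
    unfold E. replace (vscale s x) with (vscale (s / s') (vscale s' x)) by (vext; field; lra).
    apply body_shrink; auto. split; [apply Rle_mult_inv_pos; lra|].
    apply (Rmult_le_reg_r s'); [lra|]. unfold Rdiv. rewrite Rmult_assoc, Rinv_l by lra. lra. }
  (* Closedness gives attainment, through the multiples [S (1 - 1 / (k + 1))]. *)
  assert (top : E S).
  { destruct HK as [_ [_ [_ [Hcl _]]]].
    apply (Hcl (fun k => vscale (S * (1 - RinvN k)) x)).
    - intros k. apply below.
      pose proof (cond_pos (RinvN k)) as Hp.
      assert (RinvN k <= 1).
      { simpl. rewrite <- Rinv_1. apply Rinv_le_contravar; [lra|]. pose proof (pos_INR k). lra. }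
      split; nra.
    - intros i. unfold vscale.
      replace (S * x i) with (S * (1 - 0) * x i) by ring.
      apply (CV_mult (fun k => S * (1 - RinvN k)) (fun _ => x i)); [|apply cv_constant].
      apply (CV_mult (fun _ => S) (fun k => 1 - RinvN k)); [apply cv_constant|].
      apply (CV_minus (fun _ => 1) RinvN); [apply cv_constant|apply RinvN_cv]. }
  exists (/ S). split; [left; apply Rinv_0_lt_compat; auto|].
  assert (abs : forall s, K (vscale s x) -> K (vscale (Rabs s) x)).
  { intros s Hs. unfold Rabs. destruct Rcase_abs; auto.
    replace (vscale (- s) x) with (vopp (vscale s x)) by (vext; ring). apply HK; auto. }
  intros s. split.
  - intros Hs. apply abs in Hs. specialize (HS1 _ Hs).
    apply (Rmult_le_reg_r S); auto. rewrite Rmult_assoc, Rinv_l by lra. lra.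
  - intros Hs. assert (Rabs s <= S).
    { apply (Rmult_le_compat_r S) in Hs; [|lra]. rewrite Rmult_assoc, Rinv_l in Hs by lra. lra. }
    assert (Ha : K (vscale (Rabs s) x)).
    { destruct (Req_dec (Rabs s) S) as [->|]; auto. apply below.
      pose proof (Rabs_pos s). lra. }
    unfold Rabs in Ha. destruct Rcase_abs; auto.
    replace (vscale s x) with (vopp (vscale (- s) x)) by (vext; ring). apply HK; auto.
Qed.

(* Truncating first makes the norm laws hold on all of [vec], without side conditions. *)
Definition gauge (x : vec) : R :=
  epsilon (inhabits 0) (fun r => 0 <= r /\ forall s, K (vscale s (trunc m x)) <-> Rabs s * r <= 1).

Lemma gauge_spec x : 0 <= gauge x /\ forall s, K (vscale s (trunc m x)) <-> Rabs s * gauge x <= 1.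
Proof.
  unfold gauge. apply epsilon_spec. apply gauge_exists, trunc_inR.
Qed.

Lemma gauge_le r r' : 0 <= r -> 0 <= r' ->
  (forall s, Rabs s * r <= 1 -> Rabs s * r' <= 1) -> r' <= r.
Proof.
  intros Hr Hr' H. destruct (Rle_dec r' r) as [|Hlt]; auto. apply Rnot_le_lt in Hlt.
  (* The reciprocal of the mean of [r] and [r'] separates them, even when [r = 0]. *)
  specialize (H (2 / (r + r'))).
  assert (Hp : 0 < 2 / (r + r')) by (apply Rdiv_lt_0_compat; lra).
  rewrite Rabs_right in H by lra.
  set (s := 2 / (r + r')) in *.
  assert (Es : s * (r + r') = 2) by (unfold s; field; lra).
  assert (s * r <= 1) by nra. specialize (H H0). nra.
Qed.

Lemma gauge_unique x r : 0 <= r ->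
  (forall s, K (vscale s (trunc m x)) <-> Rabs s * r <= 1) -> gauge x = r.
Proof.
  intros Hr H. destruct (gauge_spec x) as [Hg Hs].
  apply Rle_antisym; apply gauge_le; auto; intros s Hle.
  - apply Hs, H; auto.
  - apply H, Hs; auto.
Qed.

Lemma gauge_ext x y : inR m x -> inR m y ->
  (forall s, K (vscale s x) <-> K (vscale s y)) -> gauge x = gauge y.
Proof.
  intros Hx Hy H. destruct (gauge_spec y) as [Hg Hs]. apply gauge_unique; auto.
  intros s. rewrite <- Hs, !trunc_id; auto.
Qed.

Lemma body_gauge x : inR m x -> (K x <-> gauge x <= 1).
Proof.
  intros Hx. destruct (gauge_spec x) as [Hg Hs]. specialize (Hs 1).
  rewrite trunc_id, vscale_1, Rabs_R1, Rmult_1_l in Hs; auto.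
Qed.

Lemma gauge_is_norm : is_norm m gauge.
Proof.
  split.
  - intros c x. destruct (gauge_spec x) as [Hg Hs]. apply gauge_unique.
    + apply Rmult_le_pos; auto. apply Rabs_pos.
    + intros s. rewrite trunc_scale, vscale_vscale, Hs, Rabs_mult, Rmult_assoc. tauto.
  - intros x y. apply le_epsilon. intros eps He.
    destruct (gauge_spec x) as [Hx Hsx]. destruct (gauge_spec y) as [Hy Hsy].
    destruct (gauge_spec (vadd x y)) as [Hxy Hsxy].
    (* Adding [eps / 2] keeps the denominators positive; the normalized vectors are then combined
       with weights [X / (X + Y)] and [Y / (X + Y)]. *)
    set (X := gauge x + eps / 2). set (Y := gauge y + eps / 2).
    assert (HX : 0 < X) by (unfold X; lra). assert (HY : 0 < Y) by (unfold Y; lra).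
    assert (Q : forall g Z, 0 < Z -> g <= Z -> Rabs (/ Z) * g <= 1).
    { intros g Z HZ Hle. pose proof (Rinv_0_lt_compat Z HZ). rewrite Rabs_right by lra.
      apply (Rmult_le_reg_l Z); auto. rewrite <- Rmult_assoc, Rinv_r by lra. lra. }
    assert (KX : K (vscale (/ X) (trunc m x))) by (apply Hsx, Q; auto; unfold X; lra).
    assert (KY : K (vscale (/ Y) (trunc m y))) by (apply Hsy, Q; auto; unfold Y; lra).
    assert (KXY : K (vscale (/ (X + Y)) (trunc m (vadd x y)))).
    { replace (vscale (/ (X + Y)) (trunc m (vadd x y))) with
        (vadd (vscale (X / (X + Y)) (vscale (/ X) (trunc m x)))
          (vscale (1 - X / (X + Y)) (vscale (/ Y) (trunc m y))))
        by (rewrite trunc_add; vext; field; lra).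
      apply HK; auto. split; [apply Rle_mult_inv_pos; lra|].
      apply (Rmult_le_reg_r (X + Y)); [lra|]. unfold Rdiv.
      rewrite Rmult_assoc, Rinv_l by lra. lra. }
    apply Hsxy in KXY. rewrite Rabs_right in KXY by (left; apply Rinv_0_lt_compat; lra).
    apply (Rmult_le_compat_l (X + Y)) in KXY; [|lra].
    rewrite <- Rmult_assoc, Rinv_r in KXY by lra. unfold X, Y in *. lra.
  - pose proof HK as [_ [_ [[M HM] _]]].
    assert (M0 : 0 <= M).
    { eapply Rle_trans; [|apply (HM vzero body_zero)]. apply norm2_ge0. }
    exists M. split; auto. intros x Hx. destruct (gauge_spec x) as [Hg Hs].
    rewrite trunc_id in Hs by auto.
    destruct Hg as [Hg|Hg].
    + assert (Kx : K (vscale (/ gauge x) x)).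
      { apply Hs. rewrite Rabs_right by (left; apply Rinv_0_lt_compat; auto).
        rewrite Rinv_l; lra. }
      apply HM in Kx. rewrite norm2_scale in Kx.
      apply (Rmult_le_compat_r (gauge x ^ 2)) in Kx; [|nra].
      replace ((/ gauge x) ^ 2 * norm2 m x * gauge x ^ 2) with (norm2 m x) in Kx by (field; lra).
      auto.
    (* With vanishing gauge, every multiple of [x] lies in the bounded set [K], so the length of [x]
       is zero. *)
    + rewrite <- Hg. replace (M * 0 ^ 2) with 0 by ring.
      apply (multiples_bounded_nonpos _ M). intros k.
      assert (Kx : K (vscale (INR k) x)) by (apply Hs; rewrite <- Hg; lra).
      apply HM in Kx. rewrite norm2_scale in Kx.
      pose proof (norm2_ge0 m x). destruct k; [simpl in *; lra|].
      rewrite S_INR in *. pose proof (pos_INR k).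
      assert (INR k + 1 <= (INR k + 1) ^ 2) by nra. nra.
Qed.
End Gauge.

(** * From sections of revolution to invariance of the gauge *)

Lemma lin_iso_zero V W f : lin_iso V W f -> V vzero -> f vzero = vzero.
Proof.
  intros [_ [_ [Hs _]]] H0. replace vzero with (vscale 0 vzero) at 1 by (vext; ring).
  rewrite Hs by auto. vext; ring.
Qed.

(** The Euclidean product is pulled back along the inverse [g] of the equivalence, and the axis is
    the image of [u]. *)
Lemma section_revolution n m a B : nonzero_vec m a -> sym_convex_body m B ->
  affine_sym_body_of_revolution n (hyperplane m a) (section (hyperplane m a) B) ->
  exists P A, revolution m (gauge m B) a P A.
Proof.
  intros Ha HB [K [[HK [u [Hu [Hu1 Hax]]]] [f [Hf Hsec]]]].
  pose proof Hf as [f_in [f_add [f_scale [f_inj f_surj]]]].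
  set (g := fun y => epsilon (inhabits vzero) (fun x => inR n x /\ f x = y)).
  assert (Hg : forall y, hyperplane m a y -> inR n (g y) /\ f (g y) = y).
  { intros y Hy. unfold g. apply epsilon_spec. auto. }
  assert (gf : forall x, inR n x -> g (f x) = x).
  { intros x Hx. destruct (Hg (f x)) as [H1 H2]; auto. }
  assert (g_add : forall x y, hyperplane m a x -> hyperplane m a y ->
    g (vadd x y) = vadd (g x) (g y)).
  { intros x y Hx Hy. destruct (Hg x Hx) as [x1 x2]. destruct (Hg y Hy) as [y1 y2].
    rewrite <- (gf (vadd (g x) (g y))) by (apply inR_add; auto).
    rewrite f_add, x2, y2; auto. }
  assert (g_scale : forall c x, hyperplane m a x -> g (vscale c x) = vscale c (g x)).
  { intros c x Hx. destruct (Hg x Hx) as [x1 x2].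
    rewrite <- (gf (vscale c (g x))) by (apply inR_scale; auto).
    rewrite f_scale, x2; auto. }
  apply nonzero_vec_norm2 in Ha. destruct Ha as [Ha Ha0].
  set (pi := fun x => vsub (trunc m x) (vscale (dot m (trunc m x) a / norm2 m a) a)).
  assert (pi_in : forall x, hyperplane m a (pi x)).
  { intros x. unfold pi. rewrite vsub_eq. split.
    - apply inR_add; [apply trunc_inR|]. repeat apply inR_scale; auto.
    - rewrite dot_add_l, !dot_scale_l. unfold norm2. unfold norm2 in Ha0. field. lra. }
  assert (pi_id : forall x, hyperplane m a x -> pi x = x).
  { intros x [Hx Ex]. unfold pi. rewrite trunc_id, Ex by auto. vext. field. lra. }
  assert (pi_add : forall x y, pi (vadd x y) = vadd (pi x) (pi y)).
  { intros. unfold pi. rewrite trunc_add, dot_add_l. vext. field. lra. }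
  assert (pi_scale : forall c x, pi (vscale c x) = vscale c (pi x)).
  { intros. unfold pi. rewrite trunc_scale, dot_scale_l. vext. field. lra. }
  assert (KB : forall x, inR n x -> (K x <-> B (f x))).
  { intros x Hx. split.
    - intros Kx. assert (S : section (hyperplane m a) B (f x)) by (apply Hsec; eauto). apply S.
    - intros Bx. assert (S : section (hyperplane m a) B (f x)) by (split; auto).
      apply Hsec in S. destruct S as [x' [Kx' E]].
      apply f_inj in E; auto; [subst; auto|]. apply HK; auto. }
  exists (fun x y => dot n (g (pi x)) (g (pi y))), (f u).
  split.
  - split; intros.
    + rewrite pi_add, g_add, dot_add_l; auto.
    + rewrite pi_scale, g_scale, dot_scale_l; auto.
    + apply dot_sym.
  - intros x Hx Hne. rewrite (pi_id x) by auto. destruct (Hg x Hx) as [x1 x2].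
    apply nonzero_vec_norm2, nonzero_vec_neq. split; auto. intros E. apply Hne.
    rewrite <- x2, E. apply (lin_iso_zero _ _ _ Hf). apply inR_vzero.
  - auto.
  - rewrite pi_id, gf; auto.
  - intros x y Hx Hy Et Eq.
    rewrite (pi_id (f u)), (gf u) in Et by auto.
    rewrite !pi_id in Et by auto. rewrite !pi_id in Eq by auto.
    destruct (Hg x Hx) as [x1 x2]. destruct (Hg y Hy) as [y1 y2].
    apply gauge_ext; [auto|apply Hx|apply Hy|].
    intros s.
    assert (Es : forall z, hyperplane m a z -> (B (vscale s z) <-> K (vscale s (g z)))).
    { intros z Hz. destruct (Hg z Hz) as [z1 z2].
      rewrite KB, f_scale, z2 by (auto; apply inR_scale; auto). tauto. }
    rewrite !Es by auto.
    set (t := s * dot n (g x) u).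
    assert (tx : dot n (vscale s (g x)) u = t) by (rewrite dot_scale_l; auto).
    assert (ty : dot n (vscale s (g y)) u = t) by (rewrite dot_scale_l, <- Et; auto).
    assert (sx : inR n (vscale s (g x))) by (apply inR_scale; auto).
    assert (sy : inR n (vscale s (g y))) by (apply inR_scale; auto).
    destruct (Hax t) as [Hno|[r [Hr Hball]]].
    + split; intros Kz; [elim (Hno _ sx tx Kz)|elim (Hno _ sy ty Kz)].
    + rewrite (Hball _ sx tx), (Hball _ sy ty).
      (* By Pythagoras, the distance to the centre [t u] of the slice depends only on [t] and the
         length, so membership agrees for [x] and [y]. *)
      assert (F : forall z, dot n (vscale s z) u = t ->
        norm2 n (vsub (vscale s z) (vscale t u)) = s ^ 2 * dot n z z - t ^ 2).
      { intros z Hz. unfold norm2 in *. rewrite vsub_eq.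
        bil (dot_bilinear n). rewrite (bil_scale _ (dot_bilinear n)) in Hz.
        rewrite (dot_sym n u z), Hu1.
        replace (t ^ 2) with (2 * t * (s * dot n z u) - t ^ 2) at 1 by (rewrite Hz; ring). ring. }
      rewrite !F, Eq by auto. tauto.
Qed.

(** * Ellipsoids *)

Lemma inR_S m x : inR m x -> inR (S m) x.
Proof. intros Hx i Hi. apply Hx. lia. Qed.

(** Gram-Schmidt by induction on the dimension: [f c] is the [Q]-projection of [delta k] to the
    first [k] coordinates, and [v] is the remainder, normalized by [l]. Injectivity follows since
    [F] turns [Q] into the Euclidean product. *)
Lemma orthonormal_coordinates Q : bilinear Q -> forall k,
  (forall x, inR k x -> x <> vzero -> 0 < Q x x) ->
  exists f, lin_iso (inR k) (inR k) f /\
    forall x y, inR k x -> inR k y -> Q (f x) (f y) = dot k x y.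
Proof.
  intros BQ. induction k as [|k IH]; intros Hpos.
  - assert (Z : forall x y, inR 0 x -> inR 0 y -> x = y).
    { intros x y Hx Hy. apply functional_extensionality; intro i.
      rewrite Hx, Hy by lia. auto. }
    exists (fun _ => vzero). split.
    + split; [intros; apply inR_vzero|]. splits; intros; try (vext; ring; fail); eauto.
      exists y. split; auto. apply Z; auto. apply inR_vzero.
    + intros x y Hx Hy. replace vzero with (vscale 0 vzero) by (vext; ring).
      bil BQ. simpl. unfold dot. simpl. ring.
  - destruct IH as [f [Hf Hiso]].
    { intros x Hx. apply Hpos. apply inR_S; auto. }
    pose proof Hf as [f_in [f_add [f_scale [f_inj f_surj]]]].
    destruct (functional_is_dot k (fun z => Q (delta k) (f z))) as [c [Hc HQc]].
    { intros x y Hx Hy. rewrite f_add by auto. bil BQ. auto. }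
    { intros r x Hx. rewrite f_scale by auto. bil BQ. auto. }
    set (v := vsub (delta k) (f c)).
    assert (Hv : inR (S k) v).
    { unfold v. rewrite vsub_eq. apply inR_add; [apply inR_delta; lia|].
      apply inR_scale, inR_S, f_in; auto. }
    assert (vk : v k = 1).
    { unfold v, vsub. rewrite delta_self, (f_in c Hc k) by lia. ring. }
    assert (Qv : forall z, inR k z -> Q v (f z) = 0).
    { intros z Hz. unfold v. bil BQ. rewrite HQc, Hiso, (dot_sym k c) by auto. ring. }
    assert (Hvv : 0 < Q v v).
    { apply Hpos; auto. intros E. rewrite E in vk. unfold vzero in vk. lra. }
    set (l := sqrt (Q v v)).
    assert (Hl : 0 < l) by (apply sqrt_lt_R0; auto).
    assert (El : l * l = Q v v) by (apply sqrt_sqrt; lra).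
    set (F := fun x : vec => vadd (f (trunc k x)) (vscale (x k / l) v)).
    assert (F_add : forall x y, F (vadd x y) = vadd (F x) (F y)).
    { intros x y. unfold F. rewrite trunc_add, f_add by apply trunc_inR. vext. field. lra. }
    assert (F_scale : forall r x, F (vscale r x) = vscale r (F x)).
    { intros r x. unfold F. rewrite trunc_scale, f_scale by apply trunc_inR. vext. field. lra. }
    assert (F_iso : forall x y, Q (F x) (F y) = dot (S k) x y).
    { intros x y. unfold F. bil BQ. rewrite (bil_sym _ BQ _ v), !Qv, Hiso by apply trunc_inR.
      rewrite <- El. unfold dot. simpl.
      rewrite (sumR_ext k _ (fun i => x i * y i)); [field; lra|].
      intros i Hi. rewrite !trunc_apply; auto. }
    exists F. split; [|intros; apply F_iso]. split; [|splits].
    + intros x Hx. unfold F. apply inR_add; [apply inR_S, f_in, trunc_inR|apply inR_scale; auto].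
    + intros; apply F_add.
    + intros; apply F_scale.
    + intros x y Hx Hy E.
      assert (D : vsub x y = vzero).
      { apply (norm2_zero (S k)).
        - rewrite vsub_eq. apply inR_add; auto. apply inR_scale; auto.
        - unfold norm2. rewrite <- F_iso, vsub_eq, F_add, F_scale, E.
          replace (vadd (F y) (vscale (-1) (F y))) with (vscale 0 (F y)) by (vext; ring).
          bil BQ. ring. }
      apply functional_extensionality; intro i. apply (f_equal (fun v => v i)) in D.
      unfold vsub, vzero in D. lra.
    + intros y Hy.
      (* Since [v] has [k]-th coordinate 1, subtracting [y k] times [v] leaves a vector covered by
         the induction hypothesis. *)
      assert (Hw : inR k (vsub y (vscale (y k) v))).
      { intros i Hi. unfold vsub, vscale. destruct (PeanoNat.Nat.eq_dec i k) as [->|Hne].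
        - rewrite vk. ring.
        - rewrite Hy, Hv by lia. ring. }
      destruct (f_surj _ Hw) as [z [Hz Ez]].
      exists (vadd z (vscale (y k * l) (delta k))). split.
      { apply inR_add; [apply inR_S; auto|apply inR_scale, inR_delta; lia]. }
      unfold F. rewrite trunc_add, trunc_scale, (trunc_id k z) by auto.
      replace (trunc k (delta k)) with vzero.
      2: { vext. unfold trunc. destruct Compare_dec.lt_dec; auto. rewrite delta_neq by lia. auto. }
      replace (vadd z (vscale (y k * l) vzero)) with z by (vext; ring).
      assert (Ek : vadd z (vscale (y k * l) (delta k)) k = y k * l).
      { unfold vadd, vscale. rewrite (Hz k), delta_self by lia. ring. }
      rewrite Ez, Ek. vext. field. lra.
Qed.

(** For [m >= 3] the equator has a nonzero vector [s]; the law in the plane of [s] and [A] spreads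
    over [a^⊥] by rotation. *)
Lemma section_quadratic_form m N a P A : (3 <= m)%nat -> is_norm m N -> revolution m N a P A ->
  (forall x y, hyperplane m a x -> hyperplane m a y -> parallelogram N x y) ->
  exists Q, bilinear Q /\ forall x, hyperplane m a x -> N x ^ 2 = Q x x.
Proof.
  intros Hm HN HP H. pose proof (rev_bil _ _ _ _ _ HP) as BP.
  destruct (functional_is_dot m (fun v => P v A)) as [p [_ Hp]];
    [intros; bil BP; auto|intros; bil BP; auto|].
  destruct (exists_orthogonal m (a :: p :: nil)) as [s [Hs Ho]]; [simpl; lia|].
  apply nonzero_vec_neq in Hs. destruct Hs as [Hs Hne].
  assert (Has : hyperplane m a s).
  { split; auto. rewrite dot_sym. apply Ho; simpl; auto. }
  destruct (axis_plane_form m N HN a P A HP s) as [c [d Hcd]]; auto.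
  - rewrite Hp, dot_sym by auto. apply Ho; simpl; auto.
  - intros. apply H; [hyp|]. pose proof (rev_axis _ _ _ _ _ HP). hyp.
  - exists (fun x y => c * P x y + d * (P x A * P y A)). split; auto.
    apply bilinear_combination; auto.
Qed.

(** The polarization [q] is defined globally, and each bilinearity identity involves at most three
    vectors; for [m >= 4] these lie in one hyperplane, where [q] agrees with a bilinear form. *)
Lemma global_quadratic_form m N : (4 <= m)%nat -> is_norm m N ->
  (forall a, nonzero_vec m a -> exists Q, bilinear Q /\
    forall x, hyperplane m a x -> N x ^ 2 = Q x x) ->
  exists Q, bilinear Q /\ forall x, inR m x -> N x ^ 2 = Q x x.
Proof.
  intros Hm HN H.
  set (q := fun x y => (N (vadd x y) ^ 2 - N (vsub x y) ^ 2) / 4).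
  assert (Hq : forall x y z, inR m x -> inR m y -> inR m z -> exists a Q, bilinear Q /\
    (hyperplane m a x /\ hyperplane m a y /\ hyperplane m a z) /\
    forall u v, hyperplane m a u -> hyperplane m a v -> q u v = Q u v).
  { intros x y z Hx Hy Hz.
    destruct (hyperplane_through m (x :: y :: z :: nil)) as [a [Ha Hin]].
    - simpl; lia.
    - simpl. intuition; subst; auto.
    - destruct (H a Ha) as [Q [BQ HQ]]. exists a, Q. split; auto. split.
      + splits; apply Hin; simpl; auto.
      + intros u v Hu Hv. unfold q. rewrite !HQ by hyp. bil BQ.
        rewrite (bil_sym _ BQ v u). field. }
  exists (fun x y => q (trunc m x) (trunc m y)). split.
  - split.
    + intros x y z.
      destruct (Hq (trunc m x) (trunc m y) (trunc m z)) as [a [Q [BQ [[Hx [Hy Hz]] E]]]];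
        try apply trunc_inR.
      rewrite trunc_add, !E by hyp. bil BQ. auto.
    + intros c x z.
      destruct (Hq (trunc m x) (trunc m x) (trunc m z)) as [a [Q [BQ [[Hx [_ Hz]] E]]]];
        try apply trunc_inR.
      rewrite trunc_scale, !E by hyp. bil BQ. auto.
    + intros x y. unfold q. f_equal. f_equal.
      * f_equal. f_equal. vext; ring.
      * replace (vsub (trunc m x) (trunc m y))
          with (vscale (-1) (vsub (trunc m y) (trunc m x))) by (vext; ring).
        rewrite (norm_scale2 m N HN). ring.
  - intros x Hx. rewrite trunc_id by auto. unfold q.
    replace (vadd x x) with (vscale 2 x) by (vext; ring).
    replace (vsub x x) with (vscale 0 x) by (vext; ring).
    rewrite !(norm_scale2 m N HN). field.
Qed.

(** In [Q]-orthonormal coordinates the gauge is the Euclidean norm, so [f] carries the unit ball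
    onto [B], with centre 0. *)
Lemma quadratic_gauge_ellipsoid m B Q : sym_convex_body m B -> bilinear Q ->
  (forall x, inR m x -> gauge m B x ^ 2 = Q x x) -> ellipsoid m B.
Proof.
  intros HB BQ HQ. pose proof (gauge_is_norm m B HB) as HN.
  destruct (orthonormal_coordinates Q BQ m) as [f [Hf Hiso]].
  { intros x Hx Hne. rewrite <- HQ by auto. pose proof (norm_pos m _ HN x Hx Hne). nra. }
  exists f, vzero. split; [auto|split; [apply inR_vzero|]].
  pose proof Hf as [f_in [_ [_ [_ f_surj]]]].
  assert (K : forall x, inR m x -> (B (f x) <-> norm2 m x <= 1)).
  { intros x Hx. rewrite (body_gauge m B HB) by auto. unfold norm2.
    rewrite <- Hiso, <- HQ by auto. pose proof (norm_ge0 m _ HN (f x)). split; nra. }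
  assert (E : forall x, vadd x vzero = x) by (intros; vext; ring).
  intros y. split.
  - intros Hy. destruct (f_surj y) as [x [Hx Ex]]; [apply HB; auto|].
    exists x. rewrite E. split; auto. split; auto. apply K; auto. rewrite Ex; auto.
  - intros [x [[Hx Hn] Ex]]. rewrite E in Ex. rewrite <- Ex. apply K; auto.
Qed.

(** A linear equivalence of sections preserves the gauge as well as sums and differences, so it
    transports the law. *)
Lemma section_equiv_parallelogram m B a b : sym_convex_body m B ->
  lin_equiv (hyperplane m a) (section (hyperplane m a) B)
            (hyperplane m b) (section (hyperplane m b) B) ->
  (forall x y, hyperplane m a x -> hyperplane m a y -> parallelogram (gauge m B) x y) ->
  forall x y, hyperplane m b x -> hyperplane m b y -> parallelogram (gauge m B) x y.
Proof.
  intros HB [f [[f_in [f_add [f_scale [f_inj f_surj]]]] Hsec]] H.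
  assert (KB : forall x, hyperplane m a x -> (B x <-> B (f x))).
  { intros x Hx. split.
    - intros Bx. apply (Hsec (f x)). exists x. split; auto. split; auto.
    - intros Bx. destruct (proj1 (Hsec (f x))) as [x' [[Hx' Bx'] E]]; [split; auto|].
      apply f_inj in E; subst; auto. }
  assert (G : forall x, hyperplane m a x -> gauge m B (f x) = gauge m B x).
  { intros x Hx. apply gauge_ext; [auto|apply f_in; auto|apply Hx|].
    intros s. rewrite <- f_scale by auto. symmetry. apply KB. hyp. }
  intros y y' Hy Hy'.
  destruct (f_surj y Hy) as [x [Hx <-]]. destruct (f_surj y' Hy') as [x' [Hx' <-]].
  specialize (H x x' Hx Hx'). unfold parallelogram in *.
  rewrite vsub_eq, <- f_scale, <- !f_add, !G, <- vsub_eq by hyp. auto.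
Qed.

Theorem theorem2 (n : nat) (hn : (4 <= n)%nat) (B : vec -> Prop)
  (hB : sym_convex_body (n + 1) B)
  (hrev : forall a, nonzero_vec (n + 1) a ->
     affine_sym_body_of_revolution n (hyperplane (n + 1) a)
       (section (hyperplane (n + 1) a) B))
  (hequiv : forall a b, nonzero_vec (n + 1) a -> nonzero_vec (n + 1) b ->
     lin_equiv (hyperplane (n + 1) a) (section (hyperplane (n + 1) a) B)
               (hyperplane (n + 1) b) (section (hyperplane (n + 1) b) B)) :
  ellipsoid (n + 1) B.
Proof.
  pose proof (gauge_is_norm _ _ hB) as HN.
  assert (Hrev : forall a, nonzero_vec (n + 1) a ->
    exists P A, revolution (n + 1) (gauge (n + 1) B) a P A).
  { intros a Ha. apply (section_revolution n); auto. }
  destruct (some_section_parallelogram (n + 1) _ ltac:(lia) HN Hrev) as [a [Ha Hpar]].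
  destruct (global_quadratic_form (n + 1) (gauge (n + 1) B)) as [Q [BQ HQ]]; auto; [lia| |].
  (* The law on [a^⊥] passes to every [b^⊥], where it yields a quadratic form. *)
  - intros b Hb. destruct (Hrev b Hb) as [P [A HP]].
    apply (section_quadratic_form _ _ b P A); auto; [lia|].
    apply (section_equiv_parallelogram _ _ a b); auto.
  - apply (quadratic_gauge_ellipsoid _ _ Q); auto.
Qed.
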